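(* Let $k$ be an algebraically closed field of characteristic zero, let $S = k[x_1,\dots,x_n]$, and let $J \subseteq \{1,\dots,n\}$. If $I \subset S$ is a $J$-cellular binomial ideal that has exactly one minimal prime, then $$\operatorname{Hull}(I) = I + M_{\mathrm{emb}}(I).$$ In particular, $\operatorname{Hull}(I)$ is a binomial ideal.
   Context: Let $k$ be an algebraically closed field of characteristic zero and $S = k[x_1,\dots,x_n]$. Binomial ideals: a binomial is a polynomial of the form $x^u - \lambda x^v$ with $u,v\in\mathbb{N}^n$ and $\lambda\in k$; monomials also count as binomials (the case $\lambda = 0$). A binomial ideal is an ideal of $S$ generated by binomials. Cellular ideals: for $J\subseteq\{1,\dots,n\}$, a binomial ideal $I\subset S$ is $J$-cellular if every variable $x_i$ with $i\in J$ is regular (a nonzerodivisor) in $S/I$ and every variable $x_i$ with $i\notin J$ is nilpotent in $S/I$. Put $\overline{J} = \{1,\dots,n\}\setminus J$, $k[J] = k[x_i : i\in J]$ and $k[\overline{J}] = k[x_i : i\notin J]$. Characters and lattice ideals: a character is a group homomorphism $\rho: L\to k^*$ from a sublattice (subgroup) $L\subseteq\mathbb{Z}^J$. Its lattice ideal is $I_{\rho,J} = \langle x^u - \rho(u-v)x^v : u,v\in\mathbb{N}^J,\ u-v\in L\rangle \subseteq k[J]$. The lattice of this lattice ideal is $L$. For a $J$-cellular binomial ideal $I$, the ideal $I\cap k[J]$ is a lattice ideal in $k[J]$. Potentially associated and embedded lattices: let $I$ be a $J$-cellular binomial ideal. A lattice $L\subseteq\mathbb{Z}^J$ is potentially associated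 to $I$ if there is a monomial $m\in k[\overline{J}]$, called a witness monomial (or witness) for $L$, such that $(I:m)\cap k[J] = I_{\rho,J}$ for some character $\rho: L\to k^*$. A potentially associated lattice is embedded if it properly contains the lattice of $I\cap k[J]$. $M_{\mathrm{emb}}(I)$ denotes the monomial ideal of $S$ generated by all witnesses of embedded lattices of $I$. $\operatorname{Hull}(I)$ denotes the intersection of the minimal primary components of $I$, that is, of the primary components in a primary decomposition of $I$ that belong to the minimal primes of $I$. *)

(* Defs.v *)
From mathcomp Require Import all_boot all_order all_algebra.
From mathcomp Require Import boolp classical_sets.
From mathcomp Require Import mpoly.

Set Implicit Arguments.
Unset Strict Implicit.
Unset Printing Implicit Defensive.

Import GRing.Theory.
Local Open Scope classical_set_scope.
Local Open Scope ring_scope.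

Section GeneratedIdeals.
Variable R : comNzRingType.

(* The ideal generated by [G] in the subring [A] of [R] (for [G] included in
   [A]); taking [A := setT] gives ideals of [R] itself. *)
Definition ideal_gen_in (A G : set R) : set R :=
  [set f | exists (r : nat) (c g : 'I_r -> R),
     [/\ forall i, A (c i), forall i, G (g i) & f = \sum_(i < r) c i * g i]].

Definition ideal_gen (G : set R) : set R := ideal_gen_in setT G.

Definition ideal_add (I K : set R) : set R := [set f + g | f in I & g in K].

Definition ideal_colon (I : set R) (m : R) : set R := [set f | I (f * m)].

Definition radical (I : set R) : set R := [set f | exists e : nat, I (f ^+ e)].

(* [idealr_closed] includes properness (1 does not belong to the ideal). *)
Definition prime_ideal (P : set R) : Prop :=
  idealr_closed (mem P) /\ prime_idealr_closed (mem P).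

Definition primary_ideal (Q : set R) : Prop :=
  idealr_closed (mem Q) /\ (forall f g, Q (f * g) -> Q f \/ radical Q g).

Definition minimal_prime (I P : set R) : Prop :=
  [/\ prime_ideal P, I `<=` P
    & forall P', prime_ideal P' -> I `<=` P' -> P' `<=` P -> P' = P].

Definition primary_decomposition (I : set R) (r : nat) (Q : 'I_r -> set R) :
    Prop :=
  (forall i, primary_ideal (Q i)) /\ I = \bigcap_i Q i.

(* The intersection of the components belonging to minimal primes is the same
   for all primary decompositions of [I], so it may be computed from any of
   them. *)
Definition Hull (I : set R) : set R :=
  [set f | exists (r : nat) (Q : 'I_r -> set R),
     primary_decomposition I Q /\
     (\bigcap_(i in [set i | minimal_prime I (radical (Q i))]) Q i) f].

End GeneratedIdeals.

Section CellularBinomialIdeals.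
Variables (k : closedFieldType) (n : nat).
Local Notation S := {mpoly k[n]}.

Definition is_binomial (f : S) : Prop :=
  exists (u v : 'X_{1..n}) (lambda : k), f = 'X_[u] - lambda *: 'X_[v].

Definition binomial_ideal (I : set S) : Prop :=
  exists2 G : set S, G `<=` is_binomial & I = ideal_gen G.

Definition cellular (J : {set 'I_n}) (I : set S) : Prop :=
  [/\ binomial_ideal I,
      forall i, i \in J -> forall f, I ('X_i * f) -> I f
    & forall i, i \notin J -> exists e : nat, I ('X_i ^+ e)].

(* N^J and Z^J are the vectors of N^n and Z^n whose support lies in [J]. *)
Definition expon_on (J : {set 'I_n}) : set 'X_{1..n} :=
  [set u | forall i, i \notin J -> u i = 0%N].

Definition Zvec_on (J : {set 'I_n}) : set 'rV[int]_n :=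
  [set a | forall i, i \notin J -> a 0 i = 0].

Definition expon_sub (u v : 'X_{1..n}) : 'rV[int]_n :=
  \row_i ((u i)%:Z - (v i)%:Z).

(* k[J], as a subring of S. *)
Definition poly_on (J : {set 'I_n}) : set S :=
  [set f | forall u, u \in msupp f -> expon_on J u].

Definition lattice (J : {set 'I_n}) (L : set 'rV[int]_n) : Prop :=
  L `<=` Zvec_on J /\ zmod_closed (mem L).

(* A group homomorphism L -> k^*, represented by a function on Z^n whose values
   outside [L] are irrelevant. *)
Definition character (L : set 'rV[int]_n) (rho : 'rV[int]_n -> k) : Prop :=
  (forall a, L a -> rho a != 0) /\
  (forall a b, L a -> L b -> rho (a + b) = rho a * rho b).

Definition lattice_ideal (J : {set 'I_n}) (L : set 'rV[int]_n)
    (rho : 'rV[int]_n -> k) : set S :=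
  ideal_gen_in (poly_on J)
    [set f | exists u v : 'X_{1..n},
       [/\ expon_on J u, expon_on J v, L (expon_sub u v)
         & f = 'X_[u] - rho (expon_sub u v) *: 'X_[v]]].

(* [A] is a lattice ideal of k[J] whose lattice is [L]. *)
Definition has_lattice (J : {set 'I_n}) (A : set S) (L : set 'rV[int]_n) :
    Prop :=
  lattice J L /\ exists2 rho, character L rho & A = lattice_ideal J L rho.

Definition witness (J : {set 'I_n}) (I : set S) (L : set 'rV[int]_n)
    (m : 'X_{1..n}) : Prop :=
  expon_on (~: J)%SET m /\
  has_lattice J (ideal_colon I 'X_[m] `&` poly_on J) L.

Definition potentially_associated (J : {set 'I_n}) (I : set S)
    (L : set 'rV[int]_n) : Prop :=
  exists m, witness J I L m.

Definition embedded (J : {set 'I_n}) (I : set S) (L : set 'rV[int]_n) : Prop :=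
  potentially_associated J I L /\
  exists2 L0, has_lattice J (I `&` poly_on J) L0 & L0 `<` L.

Definition Memb (J : {set 'I_n}) (I : set S) : set S :=
  ideal_gen [set f | exists L m,
    [/\ embedded J I L, witness J I L m & f = 'X_[m]]].

End CellularBinomialIdeals.

(* Main.v *)
Require Import Defs.
From mathcomp Require Import all_boot all_order all_algebra.
From mathcomp Require Import boolp classical_sets.
From mathcomp Require Import mpoly.
From mathcomp Require Import ring.

Set Implicit Arguments.
Unset Strict Implicit.
Unset Printing Implicit Defensive.

Import Order.TTheory GRing.Theory.
Local Open Scope classical_set_scope.
Local Open Scope ring_scope.

(* Let P be the unique minimal prime of I. Lasker-Noether gives P = rad I and
   identifies Hull I with the saturation of I by the complement of P; since the
   variables outside J lie in P, it suffices to saturate by elements of k[J]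
   outside P. Lattice ideals are radical in characteristic zero (they are the
   ideals of functions vanishing at all extensions of their character), so
   P and I meet k[J] in the same ideal.
   Binomial ideals are homogeneous for the equivalence of monomials u, v such
   that some x^u - c x^v with c <> 0 lies in I. Hence if s f is in I with s in
   k[J] outside P, then f splits along the coarser classes that are moreover
   stable under multiplication by monomials of k[J], and on such a class f is,
   up to a monomial of k[J], a multiple g x^u modulo I with g in k[J]. Then
   s g x^u is in I, so either g is in P, whence in I, or x^u is in the
   saturation. A monomial x^m of k[J-bar] outside I lies in the saturation iff
   the lattice ideal of (I : x^m) is larger than that of I, that is, iff m is a
   witness of an embedded lattice. *)

(** * Primary decompositions and the hull *)

Section Ideals.
Variable R : comNzRingType.
Implicit Types (I P Q : set R) (f g s : R).

Definition is_ideal I : Prop :=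
  [/\ I 0, forall f g, I f -> I g -> I (f + g) & forall a f, I f -> I (a * f)].

Lemma is_ideal0 I : is_ideal I -> I 0. Proof. by case. Qed.

Lemma is_idealD I f g : is_ideal I -> I f -> I g -> I (f + g).
Proof. by case=> _ + _; apply. Qed.

Lemma is_idealM I a f : is_ideal I -> I f -> I (a * f).
Proof. by case=> _ _; apply. Qed.

Lemma is_idealN I f : is_ideal I -> I f -> I (- f).
Proof. by rewrite -mulN1r; exact: is_idealM. Qed.

Lemma is_idealB I f g : is_ideal I -> I f -> I g -> I (f - g).
Proof. by move=> idI If Ig; apply: is_idealD => //; exact: is_idealN. Qed.

Lemma is_ideal_sum I (T : eqType) (r : seq T) (p : pred T) (F : T -> R) :
  is_ideal I -> (forall i, i \in r -> p i -> I (F i)) ->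
  I (\sum_(i <- r | p i) F i).
Proof.
move=> idI IF; rewrite big_seq_cond.
apply: (big_ind I); first exact: is_ideal0.
  by move=> f g; exact: is_idealD.
by move=> i /andP[ir pi]; exact: IF.
Qed.

Lemma is_idealX I f (a b : nat) :
  is_ideal I -> I (f ^+ a) -> (a <= b)%N -> I (f ^+ b).
Proof. by move=> idI Ia ab; rewrite -(subnK ab) exprD; exact: is_idealM. Qed.

Lemma idealr_closedP I : idealr_closed (mem I) <-> is_ideal I /\ ~ I 1.
Proof.
split.
  case=> I0 I1 Ilin; have {}I0 : I 0 by move: I0; rewrite inE.
  have IM a f : I f -> I (a * f).
    move=> If; rewrite -[_ * _]addr0; have /= := Ilin a f 0; rewrite !inE.
    by apply.
  split; last by move=> I1'; move/negP: I1; apply; rewrite inE.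
  split=> // f g If Ig; have /= := Ilin 1 f g; rewrite !inE mul1r.
  by apply.
case=> -[I0 ID IM] I1; split; [by rewrite inE | by apply/negP; rewrite inE |].
move=> a f g; rewrite !inE => If Ig.
by apply: ID => //; exact: IM.
Qed.

Lemma ideal_gen_in0 (A G : set R) : ideal_gen_in A G 0.
Proof.
by exists 0%N, (fun=> 0), (fun=> 0); split=> [[]//|[]//|]; rewrite big_ord0.
Qed.

Lemma ideal_gen_inD (A G : set R) f g :
  ideal_gen_in A G f -> ideal_gen_in A G g -> ideal_gen_in A G (f + g).
Proof.
move=> [r1 [c1 [g1 [A1 G1 ->]]]] [r2 [c2 [g2 [A2 G2 ->]]]].
exists (r1 + r2)%N.
exists (fun i => match split i with inl j => c1 j | inr j => c2 j end).
exists (fun i => match split i with inl j => g1 j | inr j => g2 j end).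
split; [by move=> i; case: split..|].
rewrite big_split_ord /=; congr (_ + _); apply: eq_bigr => i _.
  by rewrite (unsplitK (inl _ i)).
by rewrite (unsplitK (inr _ i)).
Qed.

Lemma ideal_gen_inM (A G : set R) a f :
  (forall b c, A b -> A c -> A (b * c)) -> A a ->
  ideal_gen_in A G f -> ideal_gen_in A G (a * f).
Proof.
move=> AM Aa [r [c [g [Ac Gg ->]]]].
exists r, (fun i => a * c i), g; split=> // [i|]; first exact: AM.
by rewrite mulr_sumr; apply: eq_bigr => i _; rewrite mulrA.
Qed.

Lemma ideal_gen_in_sub (A G : set R) a g : A a -> G g ->
  ideal_gen_in A G (a * g).
Proof.
move=> Aa Gg; exists 1%N, (fun=> a), (fun=> g); split=> //.
by rewrite big_ord1.
Qed.

Lemma is_ideal_gen (G : set R) : is_ideal (ideal_gen G).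
Proof.
split; [exact: ideal_gen_in0|exact: ideal_gen_inD|move=> a f].
exact: ideal_gen_inM.
Qed.

Lemma ideal_gen_sub (G : set R) : G `<=` ideal_gen G.
Proof.
by move=> g Gg; rewrite -[g]mul1r; exact: ideal_gen_in_sub.
Qed.

Lemma ideal_gen_in_min (A G I : set R) :
  is_ideal I -> G `<=` I -> ideal_gen_in A G `<=` I.
Proof.
move=> idI GI f [r [c [g [_ Gg ->]]]]; apply: is_ideal_sum => // i _ _.
by apply: is_idealM => //; exact: GI.
Qed.

Lemma is_ideal_colon I f : is_ideal I -> is_ideal (ideal_colon I f).
Proof.
move=> idI; split; rewrite /ideal_colon /=.
- by rewrite mul0r; exact: is_ideal0.
- by move=> g h Ig Ih; rewrite mulrDl; exact: is_idealD.
- by move=> a g Ig; rewrite -mulrA; exact: is_idealM.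
Qed.

Lemma is_ideal_add I K : is_ideal I -> is_ideal K -> is_ideal (ideal_add I K).
Proof.
move=> idI idK; split.
- by exists 0; [exact: is_ideal0|exists 0; [exact: is_ideal0|rewrite addr0]].
- move=> _ _ [a Ia [b Kb <-]] [c Ic [d Kd <-]].
  exists (a + c); first exact: is_idealD.
  by exists (b + d); [exact: is_idealD|rewrite addrACA].
- move=> a _ [b Ib [c Kc <-]]; exists (a * b); first exact: is_idealM.
  by exists (a * c); [exact: is_idealM|rewrite mulrDr].
Qed.

Lemma ideal_addl I K : is_ideal K -> I `<=` ideal_add I K.
Proof.
by move=> idK f If; exists f => //; exists 0; [exact: is_ideal0|rewrite addr0].
Qed.

Lemma ideal_addr I K : is_ideal I -> K `<=` ideal_add I K.
Proof.
by move=> idI f Kf; exists 0; [exact: is_ideal0|exists f => //; rewrite add0r].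
Qed.

Lemma is_ideal_radical I : is_ideal I -> is_ideal (radical I).
Proof.
move=> idI; split.
- by exists 1%N; rewrite expr1; exact: is_ideal0.
- move=> f g [a Ia] [b Ib]; exists (a + b)%N; rewrite exprDn.
  apply: is_ideal_sum => // i _ _; rewrite -mulr_natl; apply: is_idealM => //.
  have [bi|ib] := leqP b i.
    by apply: is_idealM => //; exact: is_idealX bi.
  rewrite mulrC; apply: is_idealM => //; apply: is_idealX Ia _ => //.
  by rewrite -addnBA ?leq_addr// ltnW.
- by move=> a f [e Ie]; exists e; rewrite exprMn; exact: is_idealM.
Qed.

Lemma sub_radical I : I `<=` radical I.
Proof. by move=> f If; exists 1%N; rewrite expr1. Qed.

Lemma prime_ideal_is_ideal P : prime_ideal P -> is_ideal P.
Proof. by case=> /idealr_closedP[]. Qed.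

Lemma prime_ideal1 P : prime_ideal P -> ~ P 1.
Proof. by case=> /idealr_closedP[]. Qed.

Lemma prime_idealM P f g : prime_ideal P -> P (f * g) -> P f \/ P g.
Proof.
case=> _ prP Pfg; have := prP f g; rewrite !inE => /(_ Pfg)/orP[];
  by rewrite inE; tauto.
Qed.

Lemma prime_ideal_prod P (T : Type) (r : seq T) (F : T -> R) :
  prime_ideal P -> P (\prod_(i <- r) F i) -> exists i, P (F i).
Proof.
move=> prP; elim: r => [|i r IHr].
  by rewrite big_nil => /(prime_ideal1 prP).
rewrite big_cons => /(prime_idealM prP)[Pi|/IHr//].
by exists i.
Qed.

Lemma prime_idealX P f e : prime_ideal P -> P (f ^+ e) -> P f.
Proof.
move=> prP; elim: e => [|e IHe]; first by rewrite expr0 => /(prime_ideal1 prP).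
by rewrite exprS => /(prime_idealM prP)[].
Qed.

Lemma radical_min I P : prime_ideal P -> I `<=` P -> radical I `<=` P.
Proof. by move=> prP IP f [e /IP]; exact: prime_idealX. Qed.

Lemma primary_is_ideal Q : primary_ideal Q -> is_ideal Q.
Proof. by case=> /idealr_closedP[]. Qed.

Lemma prime_radical_primary Q : primary_ideal Q -> prime_ideal (radical Q).
Proof.
case=> /idealr_closedP[idQ Q1] prQ; split.
  apply/idealr_closedP; split; first exact: is_ideal_radical.
  by case=> e; rewrite expr1n.
move=> f g; rewrite !inE => -[e]; rewrite exprMn => /prQ[Qf|[a Qg]].
  by apply/orP; left; rewrite inE; exists e.
by apply/orP; right; rewrite inE; exists (e * a)%N; rewrite exprM.
Qed.

(** The maximal condition rather than finite generation: [lasker_noether] uses it twice, for ideals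
    without a decomposition and for a family of colon ideals. *)
Definition noetherian : Prop :=
  forall F : set (set R), F !=set0 -> (forall I, F I -> is_ideal I) ->
  exists2 M, F M & forall I, F I -> M `<=` I -> I = M.

(** Let [M] be maximal among the ideals without a decomposition. It is not primary, so some [f * g]
    in [M] has [f] outside [M] and [g] outside its radical. For a power [h] of [g] at which the
    colons stabilise, [M] is the intersection of the strictly larger ideals [M : h] and [M + (h)],
    and their decompositions combine. *)
Lemma lasker_noether I : noetherian -> is_ideal I ->
  exists (r : nat) (Q : 'I_r -> set R), primary_decomposition I Q.
Proof.
move=> noeth idI; apply: contrapT => nodecI.
pose dec I := exists (r : nat) (Q : 'I_r -> set R), primary_decomposition I Q.
have [||M [idM nodecM] maxM] := noeth [set K | is_ideal K /\ ~ dec K].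
- by exists I.
- by move=> K [].
have decS K : is_ideal K -> M `<=` K -> K <> M -> dec K.
  by move=> idK MK; apply: contra_notP => nodecK; exact: maxM.
have M1 : ~ M 1.
  (* The unit ideal is the empty intersection. *)
  move=> M1; apply: nodecM; exists 0%N, (fun=> setT); split=> [[]//|].
  by rewrite eqEsubset; split=> [f _ []//|f _]; rewrite -[f]mulr1;
    exact: is_idealM.
have [f [g [Mfg nMf nMg]]] : exists f g, [/\ M (f * g), ~ M f & ~ radical M g].
  apply: contrapT => nprim; apply: nodecM; exists 1%N, (fun=> M); split.
    move=> _; split; first exact/idealr_closedP.
    move=> f g Mfg; have [Mf|nMf] := pselect (M f); first by left.
    right; apply: contrapT => nMg; apply: nprim; by exists f, g.
  by rewrite eqEsubset; split=> [h Mh i//|h Mh]; exact: (Mh ord0).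
(* Exponents start at 1, so that [f] lies in every colon of the family. *)
have [||_ [e _ <-] maxA] := noeth [set ideal_colon M (g ^+ e.+1) | e in setT].
- by exists (ideal_colon M (g ^+ 1)); exists 0%N.
- by move=> _ [e _ <-]; exact: is_ideal_colon.
have colonS a : ideal_colon M (g ^+ (a + e.+1)) `<=` ideal_colon M (g ^+ e.+1).
  suff -> : ideal_colon M (g ^+ (a + e.+1)) = ideal_colon M (g ^+ e.+1) by [].
  rewrite addnS; apply: maxA; first by exists (a + e)%N.
  by move=> h; rewrite /ideal_colon /= -addnS exprD mulrCA; exact: is_idealM.
pose A := ideal_colon M (g ^+ e.+1).
pose B := ideal_add M [set c * g ^+ e.+1 | c in setT].
have idg : is_ideal [set c * g ^+ e.+1 | c in setT].
  split; first by exists 0 => //; rewrite mul0r.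
    by move=> _ _ [c _ <-] [d _ <-]; exists (c + d) => //; rewrite mulrDl.
  by move=> a _ [c _ <-]; exists (a * c) => //; rewrite mulrA.
have MA : M `<=` A by move=> h Mh; rewrite /A /ideal_colon /= mulrC;
  exact: is_idealM.
have MB : M `<=` B by exact: ideal_addl.
have nAM : A <> M.
  move=> AM; apply: nMf; rewrite -AM /A /ideal_colon /= exprS mulrA mulrC.
  exact: is_idealM.
have nBM : B <> M.
  move=> BM; apply: nMg; exists e.+1; rewrite -BM; apply: ideal_addr => //.
  by exists 1 => //; rewrite mul1r.
have MAB : M = A `&` B.
  rewrite eqEsubset; split=> [h Mh|h [Ah [m Mm [_ [c _ <-] mch]]]].
    by split; [exact: MA|exact: MB].
  (* With [h = m + c * g ^+ e.+1] in [A], the product of [c] and the square of [g ^+ e.+1] lies in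
     [M], and stability of the colons removes one factor. *)
  rewrite -mch; apply: is_idealD => //; apply: (colonS e.+1).
  rewrite /ideal_colon /= exprD mulrA.
  have -> : c * g ^+ e.+1 = h - m by rewrite -mch addrC addKr.
  rewrite mulrBl; apply: is_idealB => //; rewrite mulrC; exact: is_idealM.
have [rA [QA [primA defA]]] : dec A by apply: decS => //; exact: is_ideal_colon.
have [rB [QB [primB defB]]] : dec B by apply: decS => //; exact: is_ideal_add.
apply: nodecM; exists (rA + rB)%N.
exists (fun i => match split i with inl j => QA j | inr j => QB j end).
split; first by move=> i; case: split.
rewrite MAB defA defB eqEsubset; split=> h.
  by move=> [hA hB] i _; case: split => j; [exact: hA|exact: hB].
move=> hAB; split=> j _.
  by have := hAB (unsplit (inl _ j)) Logic.I; rewrite unsplitK.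
by have := hAB (unsplit (inr _ j)) Logic.I; rewrite unsplitK.
Qed.

(** Otherwise each [Q i] has an element outside [P]; the product of these elements lies in [I],
    hence in [P], against primality. *)
Lemma primary_decomposition_prime I r (Q : 'I_r -> set R) P :
  primary_decomposition I Q -> prime_ideal P -> I `<=` P ->
  exists i, radical (Q i) `<=` P.
Proof.
move=> [primQ defI] prP IP; apply: contrapT => noQ.
have /choice[x xP] : forall i, exists x, Q i x /\ ~ P x.
  move=> i; apply: contrapT => nx; apply: noQ; exists i.
  apply: radical_min => // f Qf; apply: contrapT => nPf; apply: nx.
  by exists f.
have [|i] := @prime_ideal_prod P _ (index_enum 'I_r) x prP;
  last by case: (xP i).
apply: IP; rewrite defI => i _; rewrite (bigD1 i)//= mulrC.
by apply: is_idealM; [exact: primary_is_ideal|case: (xP i)].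
Qed.

(** Induction on the number of components whose radical lies below that of [Q i]: if the latter is
    not minimal, a strictly smaller prime over [I] contains the radical of some component, which has
    fewer components below it. *)
Lemma primary_decomposition_minimal I r (Q : 'I_r -> set R) i :
  primary_decomposition I Q ->
  exists2 j, minimal_prime I (radical (Q j)) & radical (Q j) `<=` radical (Q i).
Proof.
move=> decI; have [primQ defI] := decI.
pose below i := [set l : 'I_r | `[< radical (Q l) `<=` radical (Q i) >]]%SET.
elim: {i}_.+1 {-2}i (ltnSn #|below i|) => // c IHc i; rewrite ltnS => lec.
have [mini|nmini] := pselect (minimal_prime I (radical (Q i)));
  first by exists i.
have IQi : I `<=` radical (Q i).
  by rewrite defI => f If; apply: sub_radical; exact: If.
have [P [prP IP PQ nPQ]] : exists P, [/\ prime_ideal P, I `<=` P,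
    P `<=` radical (Q i) & P <> radical (Q i)].
  apply: contrapT => noP; apply: nmini; split=> //.
    exact: prime_radical_primary.
  move=> P prP IP PQ; apply: contrapT => nPQ; apply: noP; by exists P.
have [l QlP] := primary_decomposition_prime decI prP IP.
have [|j minj Qjl] := IHc l.
  apply: leq_trans lec; apply: proper_card; apply/properP; split.
    apply/fintype.subsetP => j; rewrite !inE => Qjl.
    exact: (subset_trans Qjl (subset_trans QlP PQ)).
  exists i; rewrite inE; first exact: asboolT.
  apply/negP; rewrite inE => Qil; apply: nPQ; rewrite eqEsubset; split=> //.
  exact: subset_trans QlP.
by exists j => //; exact: (subset_trans Qjl (subset_trans QlP PQ)).
Qed.

(** * Ideals with a unique minimal prime *)

Section UniqueMinimalPrime.
Variables I P : set R.
Hypotheses (noeth : noetherian) (idI : is_ideal I).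
Hypotheses (minP : minimal_prime I P)
  (uniqP : forall P', minimal_prime I P' -> P' = P).

(** The radical of each component contains a minimal one, which is [P]; for an element of [P], the
    sum of the exponents needed for the components serves all of them. *)
Lemma unique_minimal_prime_radical : P = radical I.
Proof.
have [prP IP _] := minP.
rewrite eqEsubset; split; last exact: radical_min.
have [r [Q decI]] := lasker_noether noeth idI.
have [primQ defI] := decI.
have PQ i : P `<=` radical (Q i).
  by have [j /uniqP ->] := primary_decomposition_minimal i decI.
move=> f Pf; have /choice[e fe] i : exists e, Q i (f ^+ e) by exact: PQ.
exists (\sum_i e i)%N; rewrite defI => i _.
apply: is_idealX (fe i) _; first exact: primary_is_ideal.
by rewrite (bigD1 i)//= leq_addr.
Qed.

(** A component with radical [P] absorbs multipliers outside [P]. Every other component contains an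
    element outside [P], and the product of such elements carries the hull into [I]. *)
Lemma Hull_unique_minimal_prime :
  Hull I = [set f | exists2 s, ~ P s & I (s * f)].
Proof.
have [prP IP _] := minP.
rewrite eqEsubset; split=> f.
  move=> [r [Q [decI hf]]]; have [primQ defI] := decI.
  have /choice[s sP] i : exists s, ~ P s /\ Q i (s * f).
    have [mini|nmini] := pselect (minimal_prime I (radical (Q i))).
      exists 1; split; first exact: prime_ideal1.
      by rewrite mul1r; exact: hf.
    have [s [[e Qs] nPs]] : exists s, radical (Q i) s /\ ~ P s.
      apply: contrapT => nos; apply: nmini.
      suff -> : radical (Q i) = P by [].
      rewrite eqEsubset; split.
        by move=> s Qs; apply: contrapT => nPs; apply: nos; exists s.
      by have [j /uniqP ->] := primary_decomposition_minimal i decI.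
    exists (s ^+ e); split; first by move/(prime_idealX prP).
    by rewrite mulrC; apply: is_idealM => //; exact: primary_is_ideal.
  exists (\prod_i s i).
    by move/(prime_ideal_prod prP) => [i]; case: (sP i).
  rewrite defI => i _; rewrite (bigD1 i)//= mulrAC mulrC.
  by apply: is_idealM; [exact: primary_is_ideal|case: (sP i)].
move=> [s nPs Isf]; have [r [Q decI]] := lasker_noether noeth idI.
have [primQ defI] := decI.
exists r, Q; split=> // i /uniqP QP.
have [_ /(_ f s)] := primQ i; rewrite QP mulrC.
case=> //; move: Isf; rewrite defI => /(_ i).
exact.
Qed.

End UniqueMinimalPrime.

End Ideals.

(** * Polynomial rings are Noetherian *)

(** Repeatedly jump to an index at which the remaining tail attains its minimum. *)
Lemma nondecreasing_subsequence (u : nat -> nat) :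
  exists2 phi : nat -> nat, {homo phi : i j / (i < j)%N} &
    {homo u \o phi : i j / (i <= j)%N}.
Proof.
have /choice[m mP] i : exists m, (i <= m)%N /\
    forall j, (i <= j)%N -> (u m <= u j)%N.
  have [|_ /asboolP[m [im ->]] minm] :=
      @ex_minnP (fun c => `[< exists m, (i <= m)%N /\ c = u m >]).
    by exists (u i); apply/asboolP; exists i.
  exists m; split=> // j ij; apply: minm; apply/asboolP; by exists j.
pose phi k := iter k (fun i => m i.+1) (m 0%N).
have phiS k : (phi k < phi k.+1)%N by case: (mP (phi k).+1).
exists phi; first exact: (homo_ltn ltn_trans).
apply: (homo_leq leqnn leq_trans) => -[|k] /=.
  by have [_] := mP 0%N; apply.
have [_] := mP (phi k).+1; apply.
by rewrite -/(phi k.+2); apply: (leq_trans (phiS k)); exact: ltnW (phiS k.+1).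
Qed.

(** Pass to subsequences one coordinate at a time until all coordinates are nondecreasing; two
    consecutive terms then do. *)
Lemma dickson n (u : nat -> 'X_{1..n}) :
  exists i j, (i < j)%N /\ (u i <= u j)%MM.
Proof.
have [phi homophi uphi] : exists2 phi : nat -> nat,
    {homo phi : i j / (i < j)%N} &
    forall c, c \in enum 'I_n ->
      {homo (fun i => u (phi i) c) : i j / (i <= j)%N}.
  elim: (enum 'I_n) => [|c s [phi homophi uphi]]; first by exists id.
  have [psi homopsi upsi] := nondecreasing_subsequence (fun i => u (phi i) c).
  exists (phi \o psi) => [i j ij|d]; first by apply: homophi; exact: homopsi.
  rewrite inE => /predU1P[->//|ds] i j ij; apply: uphi => //.
  by move: ij; rewrite leq_eqVlt => /predU1P[->|/homopsi/ltnW].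
exists (phi 0%N), (phi 1%N); split; first exact: homophi.
by apply/mnm_lepP => c; apply: uphi => //; rewrite mem_enum.
Qed.

Lemma mpolyX_neq0 (R : nzRingType) n (u : 'X_{1..n}) :
  'X_[u] != 0 :> {mpoly R[n]}.
Proof. by rewrite -msupp_eq0 msuppX. Qed.

Lemma minimal_mlead (k : fieldType) n (F : set {mpoly k[n]}) :
  F !=set0 -> exists2 f, F f & forall g, F g -> (mlead f <= mlead g)%O.
Proof.
move=> [f Ff]; apply: contrapT => nomin.
suff : forall m f, F f -> mlead f <> m by move=> /(_ _ _ Ff)/(_ erefl).
apply: (ltmwf (P := fun m => forall f, F f -> mlead f <> m)).
move=> m IHm {}f {}Ff fm; apply: nomin; exists f => // g Fg.
by rewrite leNgt; apply/negP => lt_gf;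
apply: (IHm (mlead g) _ g); rewrite -?fm.
Qed.

(* A strictly increasing chain of ideals yields, by minimality of the leading
   monomials of the [f i] below, a sequence contradicting Dickson's lemma. *)
Lemma mpoly_noetherian (k : fieldType) n : noetherian {mpoly k[n]}.
Proof.
move=> F [I0 FI0] idF; apply: contrapT => nomax.
have /choice[next nextP] : forall I, exists I', F I ->
    [/\ F I', I `<=` I' & ~ I' `<=` I].
  move=> I; apply: contrapT => noI; apply: nomax.
  have FI : F I by apply: contrapT => nFI; apply: noI; exists I.
  exists I => // I' FI' II'; rewrite eqEsubset; split=> //.
  by apply: contrapT => nI'I; apply: noI; exists I'.
pose C i := iter i next I0.
have FC i : F (C i) by elim: i => //= i FCi; case: (nextP _ FCi).
have CS i : C i `<=` C i.+1 by case: (nextP _ (FC i)).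
have Cle i j : (i <= j)%N -> C i `<=` C j.
  elim: j => [|j IHj]; first by rewrite leqn0 => /eqP->.
  rewrite leq_eqVlt => /predU1P[->//|/IHj Cij].
  exact: (classical_sets.subset_trans Cij).
have /choice[f fP] i : exists f, [/\ C i.+1 f, ~ C i f &
    forall g, C i.+1 g -> ~ C i g -> (mlead f <= mlead g)%O].
  have [|f [CSf Cf] minf] := @minimal_mlead k n (C i.+1 `\` C i).
    have [_ _ nC] := nextP _ (FC i); apply: contrapT => n0; apply: nC.
    by move=> f Cf; apply: contrapT => nCf; apply: n0; exists f.
  by exists f; split=> // g CSg nCg; apply: minf.
have f0 i : f i != 0.
  apply/eqP => fi0; case: (fP i) => _ + _; apply; rewrite fi0.
  exact: is_ideal0 (idF _ (FC _)).
have [i [j [ij lij]]] := dickson (fun i => mlead (f i)).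
have [CSfj nCfj minfj] := fP j.
have [Cfi _ _] := fP i.
have lc i' : mleadc (f i') != 0 by rewrite mleadc_eq0.
(* The multiple of [f i] with the same leading term as [f j]. As [g] is in [C j], the difference
   [f j - g] is still in [C j.+1] but not in [C j], although its leading monomial is smaller. *)
pose g := (mleadc (f j) / mleadc (f i)) *:
  ('X_[mlead (f j) - mlead (f i)] * f i).
have Cg : C j g.
  rewrite /g -mul_mpolyC mulrA; apply: is_idealM (idF _ (FC j)) _.
  exact: (Cle _ _ ij).
have nCfjg : ~ C j (f j - g).
  by move=> /is_idealD/(_ Cg); rewrite subrK => /(_ (idF _ (FC j))).
have leadg : mlead g = mlead (f j).
  rewrite /g mleadZ ?mulf_neq0 ?invr_eq0// mleadM ?mpolyX_neq0// mleadXm.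
  by rewrite submK.
have coefg : g@_(mlead (f j)) = mleadc (f j).
  rewrite -[X in g@_X]leadg mleadcZE mleadM ?mpolyX_neq0// mleadcM mleadXm
    mcoeffX eqxx.
  rewrite mul1r divfK//.
have fjg0 : f j - g != 0.
  by apply/eqP => fjg0; apply: nCfjg; rewrite fjg0;
    exact: is_ideal0 (idF _ (FC _)).
have lefjg : (mlead (f j - g) <= mlead (f j))%O.
  by rewrite (le_trans (mleadB_le _ _))// leadg joinxx.
have /eqP : mlead (f j - g) = mlead (f j).
  apply: le_anti; rewrite lefjg minfj//.
  by apply: is_idealB (idF _ (FC j.+1)) _ _ => //; exact: CS.
apply/negP; apply: contraTneq fjg0 => leadfjg.
by rewrite negbK -mleadc_eq0 leadfjg mcoeffB coefg subrr.
Qed.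

(** * Extension of characters *)

Section Characters.
Variables (V : zmodType) (k : closedFieldType).
Implicit Types (L : set V) (rho : V -> k).

Definition is_subgroup L : Prop := L 0 /\ forall a b, L a -> L b -> L (a - b).

Lemma zmod_closedP L : zmod_closed (mem L) <-> is_subgroup L.
Proof.
split=> -[L0 LB]; split.
- by move: L0; rewrite inE.
- by move=> a b La Lb; have := LB a b; rewrite !inE; apply.
- by rewrite inE.
- by move=> a b; rewrite !inE; exact: LB.
Qed.

Lemma is_subgroupN L a : is_subgroup L -> L a -> L (- a).
Proof. by move=> [L0 LB] La; rewrite -sub0r; exact: LB. Qed.

Lemma is_subgroupD L a b : is_subgroup L -> L a -> L b -> L (a + b).
Proof.
move=> sgL La Lb; rewrite -[b]opprK; case: (sgL) => _; apply=> //.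
exact: is_subgroupN.
Qed.

Lemma is_subgroupMz L a z : is_subgroup L -> L a -> L (a *~ z).
Proof.
move=> sgL La; have LMn m : L (a *+ m).
  elim: m => [|m IHm]; first by rewrite mulr0n; case: sgL.
  by rewrite mulrS; exact: is_subgroupD.
case: z => m; first by rewrite -pmulrn.
by rewrite NegzE mulrNz -pmulrn; exact: is_subgroupN.
Qed.

Definition char_on L rho : Prop :=
  (forall a, L a -> rho a != 0) /\
  (forall a b, L a -> L b -> rho (a + b) = rho a * rho b).

Lemma char_on0 L rho : is_subgroup L -> char_on L rho -> rho 0 = 1.
Proof.
move=> [L0 _] [rho0 rhoD]; apply: (mulfI (rho0 0 L0)).
by rewrite -rhoD// addr0 mulr1.
Qed.

Lemma char_onN L rho a : is_subgroup L -> char_on L rho -> L a ->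
  rho (- a) = (rho a)^-1.
Proof.
move=> sgL chi La; have [rho0 rhoD] := chi; apply: (mulfI (rho0 a La)).
rewrite -rhoD ?subrr ?(char_on0 sgL chi) ?mulfV ?rho0//.
exact: is_subgroupN.
Qed.

Lemma char_onMz L rho a z : is_subgroup L -> char_on L rho -> L a ->
  rho (a *~ z) = rho a ^ z.
Proof.
move=> sgL chi La; have [rho0 rhoD] := chi.
have rhoMn m : rho (a *~ m%:Z) = rho a ^+ m.
  elim: m => [|m IHm]; first by rewrite mulr0z (char_on0 sgL chi).
  by rewrite intS mulrzDr mulr1z rhoD ?IHm ?exprS//; exact: is_subgroupMz.
case: z => m; first exact: rhoMn.
rewrite NegzE mulrNz (char_onN sgL chi) ?rhoMn ?exprnN//.
exact: is_subgroupMz.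
Qed.

Lemma is_subgroup_adjoin L a : is_subgroup L ->
  is_subgroup [set b | exists z : int, L (b - a *~ z)].
Proof.
move=> [L0 LB]; split; first by exists 0; rewrite mulr0z subr0.
move=> b c [z Lz] [w Lw]; exists (z - w).
have -> : b - c - a *~ (z - w) = (b - a *~ z) - (c - a *~ w).
  by rewrite mulrzBr !opprD !opprK addrACA.
exact: LB.
Qed.

(** The extension sends [b] to [rho (b - a *~ z) * c ^ z], for any [z] such that [b - a *~ z] is in
    [L]; the condition on [c] makes this independent of [z]. *)
Lemma char_adjoin L rho a c : is_subgroup L -> char_on L rho -> c != 0 ->
  (forall z, L (a *~ z) -> rho (a *~ z) = c ^ z) ->
  exists rho', [/\ char_on [set b | exists z : int, L (b - a *~ z)] rho',
    forall b, L b -> rho' b = rho b & rho' a = c].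
Proof.
move=> sgL chi c0 rhoc; have [L0 LB] := sgL; have [rho0 rhoD] := chi.
have wd b z w : L (b - a *~ z) -> L (b - a *~ w) ->
    rho (b - a *~ z) * c ^ z = rho (b - a *~ w) * c ^ w.
  move=> Lz Lw; have Lwz : L (a *~ (w - z)).
    rewrite mulrzBr; have := LB _ _ Lz Lw.
    by rewrite opprB addrC addrA subrK.
  have -> : b - a *~ z = (b - a *~ w) + a *~ (w - z).
    by rewrite mulrzBr addrA subrK.
  by rewrite rhoD// rhoc// -mulrA -expfzDr// subrK.
(* A choice of [z] for each [b], with default 0 outside the enlarged subgroup. *)
have /choice[zf zfP] : forall b, exists z : int,
    (exists w : int, L (b - a *~ w)) -> L (b - a *~ z).
  move=> b; have [[w Lw]|nL] := pselect (exists w : int, L (b - a *~ w)).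
    by exists w.
  by exists 0.
have rhoE b z : L (b - a *~ z) ->
    rho (b - a *~ zf b) * c ^ (zf b) = rho (b - a *~ z) * c ^ z.
  by move=> Lz; apply: wd => //; apply: zfP; exists z.
exists (fun b => rho (b - a *~ zf b) * c ^ (zf b)); split.
- split=> [b [z Lz]|b d [z Lz] [w Lw]].
    by rewrite (rhoE _ _ Lz) mulf_neq0 ?rho0// expfz_neq0.
  have E : b + d - a *~ (z + w) = (b - a *~ z) + (d - a *~ w).
    by rewrite mulrzDr opprD addrACA.
  rewrite (rhoE _ (z + w)) ?E; last exact: is_subgroupD.
  by rewrite (rhoE _ _ Lz) (rhoE _ _ Lw) rhoD// expfzDr// mulrACA.
- by move=> b Lb; rewrite (rhoE _ 0) mulr0z subr0 ?expr0z ?mulr1.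
- by rewrite (rhoE _ 1) mulr1z subrr ?expr1z// (char_on0 sgL chi) mul1r.
Qed.

(** The integers [z] with [a *~ z] in [L] form a subgroup of the integers, which is zero or
    generated by its least positive element. *)
Lemma multiples_in_subgroup L a : is_subgroup L ->
  (forall z, L (a *~ z) -> z = 0) \/
  exists2 d : nat, (0 < d)%N /\ L (a *+ d) &
    forall z, L (a *~ z) -> exists q : int, z = d%:Z * q.
Proof.
move=> sgL; have [[d0 d0P]|nod] :=
    pselect (exists d : nat, (0 < d)%N && `[< L (a *+ d) >]); last first.
  left=> -[[|m]|m] Lm //; exfalso; apply: nod; exists m.+1; apply/asboolP.
    by rewrite pmulrn.
  by move/(is_subgroupN sgL): Lm; rewrite NegzE mulrNz opprK -pmulrn.
have [d /andP[d_gt0 /asboolP Ld] mind] :=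
  @ex_minnP (fun d => (0 < d)%N && `[< L (a *+ d) >]) (ex_intro _ d0 d0P).
right; exists d => // z Lz; exists (z %/ d)%Z.
have zE := divz_eq z d; set r := (z %% d)%Z in zE.
have Lr : L (a *~ r).
  have -> : r = z - (z %/ d)%Z * d by rewrite [X in X - _]zE addrC addKr.
  rewrite mulrzBr; case: (sgL) => _; apply=> //.
  by rewrite mulrC mulrzA -pmulrn; exact: is_subgroupMz.
suff r0 : r = 0 by rewrite [LHS]zE r0 addr0 mulrC.
have : 0 <= r by rewrite modz_ge0// eqz_nat -lt0n.
have : r < d by rewrite ltz_pmod.
case: r Lr {zE} => // -[//|m] Lm ltmd _.
have := mind m.+1; rewrite /= pmulrn => /(_ (asboolT Lm)).
by rewrite leqNgt -ltz_nat ltmd.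
Qed.

(** If [d] is the least positive integer with [a *+ d] in [L], take a [d]-th root of [rho (a *+ d)],
    which exists since [k] is algebraically closed; if there is no such [d], take 1. *)
Lemma char_value L rho a : is_subgroup L -> char_on L rho ->
  exists2 c : k, c != 0 & forall z, L (a *~ z) -> rho (a *~ z) = c ^ z.
Proof.
move=> sgL chi; have [L0|[d [d_gt0 Ld] Lmul]] := multiples_in_subgroup a sgL.
  exists 1; first exact: oner_neq0.
  by move=> z /L0 ->; rewrite mulr0z expr0z (char_on0 sgL chi).
have rhod0 : rho (a *+ d) != 0 by case: chi => rho0 _; exact: rho0.
have [c] : exists c, root ('X^d - (rho (a *+ d))%:P) c.
  by apply/closed_rootP; rewrite size_XnsubC// eqSS -lt0n.
rewrite /root !hornerE subr_eq0 => /eqP cd.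
exists c.
  by apply: contraNneq rhod0 => c0; rewrite -cd c0 expr0n -[d]prednK.
move=> z /Lmul[q ->].
by rewrite mulrzA -pmulrn (char_onMz _ sgL chi)// -cd -exprz_exp.
Qed.

(** If [a] has finite order [d] modulo [L], then [d > 1] and a nontrivial [d]-th root of unity is
    needed. A root of [1 + X + ... + X^(d-1)] is one, because the value at 1 is [d], nonzero in
    characteristic zero. If the order is infinite, 2 will do. *)
Lemma trivial_char_value L a : [pchar k] =i pred0 -> is_subgroup L -> ~ L a ->
  exists c : k, [/\ c != 0, c != 1 & forall z, L (a *~ z) -> 1 = c ^ z].
Proof.
move=> /pcharf0P k0 sgL nLa.
have natr0 m : (m.+1%:R : k) != 0 by rewrite k0.
have [L0|[d [d_gt0 Ld] Lmul]] := multiples_in_subgroup a sgL.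
  exists 2; split; first exact: natr0.
    by rewrite -subr_eq0 -[2]/(1 + 1) addrK oner_neq0.
  by move=> z /L0 ->; rewrite expr0z.
have d_gt1 : (1 < d)%N.
  rewrite ltn_neqAle d_gt0 andbT; apply: contra_notN nLa => /eqP d1.
  by move: Ld; rewrite -d1.
pose p : {poly k} := \sum_(i < d) 'X^i.
have p_poly : p = \poly_(i < d) 1.
  by rewrite poly_def; apply: eq_bigr => i _; rewrite scale1r.
have [c pc] : exists c, root p c.
  by apply/closed_rootP; rewrite p_poly size_poly_eq ?oner_neq0// gtn_eqF.
have cd : c ^+ d = 1.
  apply/eqP; rewrite -subr_eq0 subrX1.
  move: pc; rewrite /root /p horner_sum => /eqP pc.
  rewrite (eq_bigr (fun i : 'I_d => ('X^i).[c])) ?pc ?mulr0// => i _.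
  by rewrite hornerXn.
exists c; split.
- apply/eqP => c0; move: cd; rewrite c0 expr0n -[d]prednK// => /eqP.
  by rewrite eq_sym oner_eq0.
- apply: contraTneq pc => ->; rewrite /root p_poly horner_poly.
  rewrite (eq_bigr (fun=> 1)); last by move=> i _; rewrite expr1n mulr1.
  by rewrite sumr_const card_ord -[d]prednK// natr0.
- by move=> z /Lmul[q ->]; rewrite -exprz_exp -exprnP cd exp1rz.
Qed.

Lemma char_extend_seq L rho (s : seq V) : is_subgroup L -> char_on L rho ->
  exists L' rho', [/\ is_subgroup L', char_on L' rho', L `<=` L',
    forall a, L a -> rho' a = rho a & forall a, a \in s -> L' a].
Proof.
move=> sgL chi; elim: s => [|a s [L' [rho' [sgL' chi' LL' rhoE sL']]]].
  by exists L, rho; split.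
have [c c0 rhoc] := char_value a sgL' chi'.
have [rho2 [chi2 rho2E _]] := char_adjoin sgL' chi' c0 rhoc.
have L'L2 b : L' b -> exists z : int, L' (b - a *~ z).
  by exists 0; rewrite mulr0z subr0.
eexists; exists rho2.
split; [exact: is_subgroup_adjoin sgL' | exact: chi2 | | |].
- by move=> b Lb; apply: L'L2; exact: LL'.
- by move=> b Lb; rewrite rho2E ?rhoE//; exact: LL'.
- move=> b; rewrite inE => /predU1P[->|/sL' /L'L2//].
  by exists 1; rewrite mulr1z subrr; case: sgL'.
Qed.

End Characters.

Section IntegerVectors.
Variables (k : closedFieldType) (n : nat).
Implicit Types (L : set 'rV[int]_n).

Lemma char_extend L (rho : 'rV[int]_n -> k) : is_subgroup L -> char_on L rho ->
  exists2 chi, char_on setT chi & forall a, L a -> chi a = rho a.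
Proof.
move=> sgL chi.
have [L' [rho' [sgL' chi' _ rhoE sL']]] :=
  char_extend_seq [seq delta_mx 0 i | i <- enum 'I_n] sgL chi.
exists rho' => //; suff <- : L' = setT by [].
rewrite eqEsubset; split=> // b _; rewrite [b]row_sum_delta.
apply: (big_ind L'); [by case: sgL' | by move=> x y; exact: is_subgroupD |].
move=> i _; rewrite -[b 0 i]intz scaler_int; apply: is_subgroupMz => //.
by apply: sL'; apply: map_f; rewrite mem_enum.
Qed.

(** Extend the trivial character of [L] to [a] by a value other than 1, then to all of Z^n. *)
Lemma char_separate L a : [pchar k] =i pred0 -> is_subgroup L -> ~ L a ->
  exists psi : 'rV[int]_n -> k, [/\ char_on setT psi, forall b, L b -> psi b = 1
    & psi a != 1].
Proof.
move=> k0 sgL nLa.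
have chi1 : char_on L (fun=> 1 : k).
  by split=> *; rewrite ?oner_neq0 ?mulr1.
have [c [c0 c1 Lc]] := trivial_char_value k0 sgL nLa.
have [rho [chi rho1 rhoa]] := char_adjoin sgL chi1 c0 Lc.
have [psi chipsi psiE] := char_extend (is_subgroup_adjoin a sgL) chi.
exists psi; split=> // [b Lb|].
  by rewrite psiE ?rho1//; exists 0; rewrite mulr0z subr0.
rewrite psiE ?rhoa//; exists 1; rewrite mulr1z subrr; by case: sgL.
Qed.

End IntegerVectors.

(** * Lattice ideals *)

Section Weights.
Variables (k : fieldType) (n : nat).
Implicit Types (f g : {mpoly k[n]}) (F : 'X_{1..n} -> k).

(** Used with [F] built from a character, to twist polynomials, and with [F] an indicator function,
    to cut out a class of monomials. *)
Definition mreweight F f : {mpoly k[n]} :=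
  \sum_(w <- msupp f) (f@_w * F w) *: 'X_[w].

Lemma mcoeff_mreweight F f v : (mreweight F f)@_v = f@_v * F v.
Proof.
rewrite /mreweight raddf_sum /=; have [vf|vf] := boolP (v \in msupp f).
  rewrite (bigD1_seq v) ?msupp_uniq//= mcoeffZ mcoeffX eqxx mulr1.
  rewrite big1_seq ?addr0// => w /andP[wv _].
  by rewrite mcoeffZ mcoeffX (negbTE wv) mulr0.
rewrite (memN_msupp_eq0 vf) mul0r big1_seq// => w /andP[_ wf].
rewrite mcoeffZ mcoeffX; case: eqVneq => [wv|]; last by rewrite mulr0.
by rewrite -wv wf in vf.
Qed.

Lemma mreweightD F f g : mreweight F (f + g) = mreweight F f + mreweight F g.
Proof.
by apply/mpolyP => v; rewrite mcoeffD !mcoeff_mreweight mcoeffD mulrDl.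
Qed.

Lemma mreweightZ F c f : mreweight F (c *: f) = c *: mreweight F f.
Proof.
by apply/mpolyP => v; rewrite mcoeffZ !mcoeff_mreweight mcoeffZ mulrA.
Qed.

Lemma mreweightX F u : mreweight F 'X_[u] = F u *: 'X_[u].
Proof.
apply/mpolyP => v; rewrite mcoeff_mreweight mcoeffZ mcoeffX.
by case: eqVneq => [->|]; rewrite ?mul0r ?mulr0// mul1r mulr1.
Qed.

Lemma mreweight0 F : mreweight F 0 = 0.
Proof. by apply/mpolyP => v; rewrite mcoeff_mreweight !mcoeff0 mul0r. Qed.

Lemma mreweight_sum F (T : Type) (r : seq T) (p : pred T)
    (h : T -> {mpoly k[n]}) :
  mreweight F (\sum_(i <- r | p i) h i) = \sum_(i <- r | p i) mreweight F (h i).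
Proof. exact: (big_morph _ (mreweightD F) (mreweight0 F)). Qed.

Lemma msupp_mreweight F f : {subset msupp (mreweight F f) <= msupp f}.
Proof.
move=> v; rewrite !mcoeff_msupp mcoeff_mreweight.
by apply: contraNneq => ->; rewrite mul0r.
Qed.

Lemma msupp_size_lt f g u : {subset msupp g <= msupp f} -> u \in msupp f ->
  u \notin msupp g -> (size (msupp g) < size (msupp f))%N.
Proof.
move=> gf uf ug; apply: (@uniq_leq_size _ (u :: msupp g)).
  by rewrite /= ug msupp_uniq.
by move=> v; rewrite inE => /predU1P[->//|/gf].
Qed.

End Weights.

Section LatticeIdeals.
Variables (k : closedFieldType) (n : nat) (J : {set 'I_n}).
Implicit Types (f g h : {mpoly k[n]}) (u v w : 'X_{1..n}) (L : set 'rV[int]_n).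
Implicit Types (rho chi psi : 'rV[int]_n -> k).

Lemma expon_on0 : expon_on J 0%MM.
Proof. by move=> i _; rewrite mnm0E. Qed.

Lemma expon_onD u v : expon_on J u -> expon_on J v -> expon_on J (u + v)%MM.
Proof. by move=> uJ vJ i iJ; rewrite mnmDE uJ ?vJ. Qed.

Lemma poly_on_monomial u : expon_on J u -> poly_on J ('X_[u] : {mpoly k[n]}).
Proof. by move=> uJ v; rewrite msuppX inE => /eqP->. Qed.

Lemma poly_onC c : poly_on J (c%:MP : {mpoly k[n]}).
Proof.
move=> v; rewrite msuppC; case: ifP => // _; rewrite inE => /eqP->.
exact: expon_on0.
Qed.

Lemma poly_onD f g : poly_on J f -> poly_on J g -> poly_on J (f + g).
Proof. by move=> fJ gJ v /msuppD_le; rewrite mem_cat => /orP[/fJ|/gJ]. Qed.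

Lemma poly_onM f g : poly_on J f -> poly_on J g -> poly_on J (f * g).
Proof.
move=> fJ gJ v /msuppM_le/allpairsP[[u w] /= [/fJ uJ /gJ wJ ->]].
exact: expon_onD.
Qed.

Lemma poly_onZ c f : poly_on J f -> poly_on J (c *: f).
Proof. by move=> fJ v /msuppZ_le /fJ. Qed.

Lemma poly_onB f g : poly_on J f -> poly_on J g -> poly_on J (f - g).
Proof.
by move=> fJ gJ; rewrite -scaleN1r; apply: poly_onD => //; exact: poly_onZ.
Qed.

Lemma poly_onXn e f : poly_on J f -> poly_on J (f ^+ e).
Proof.
move=> fJ; elim: e => [|e IHe]; first exact: poly_onC.
by rewrite exprS; exact: poly_onM.
Qed.

Lemma poly_on_sum (T : eqType) (r : seq T) (F : T -> {mpoly k[n]}) :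
  (forall i, i \in r -> poly_on J (F i)) -> poly_on J (\sum_(i <- r) F i).
Proof.
move=> FJ; rewrite big_seq_cond; apply: (big_ind (poly_on J)).
- by rewrite -mpolyC0; exact: poly_onC.
- by move=> f g; exact: poly_onD.
- by move=> i /andP[ir _]; exact: FJ.
Qed.

Definition expvec u : 'rV[int]_n := expon_sub u 0%MM.

Lemma expvecD u v : expvec (u + v)%MM = expvec u + expvec v.
Proof. by apply/rowP => i; rewrite !mxE mnmDE mnm0E !subr0 PoszD. Qed.

Lemma expvecB u v : expon_sub u v = expvec u - expvec v.
Proof. by apply/rowP => i; rewrite !mxE mnm0E !subr0. Qed.

Lemma Zvec_on_expon_sub u v : expon_on J u -> expon_on J v ->
  Zvec_on J (expon_sub u v).
Proof. by move=> uJ vJ i iJ; rewrite mxE uJ// vJ// subrr. Qed.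

Lemma Zvec_on_decomp a : Zvec_on J a ->
  exists u v, [/\ expon_on J u, expon_on J v & a = expon_sub u v].
Proof.
(* Positive and negative parts of [a]; [Negz m] stands for [-(m + 1)]. *)
move=> aJ; exists [multinom (if a 0%R i is Posz m then m else 0%N) | i < n].
exists [multinom (if a 0%R i is Negz m then m.+1 else 0%N) | i < n]; split.
- by move=> i iJ; rewrite mnmE aJ.
- by move=> i iJ; rewrite mnmE aJ.
- apply/rowP => i; rewrite !mxE !mnmE; case: (a 0 i) => m;
    first by rewrite subr0.
  by rewrite sub0r NegzE.
Qed.

(** The point of the torus that corresponds to the character [chi] of Z^n: evaluating a monomial
    there is applying [chi] to its exponent. *)
Definition char_point chi : 'I_n -> k := fun i => chi (delta_mx 0 i).

Lemma char_pointX chi u : char_on setT chi ->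
  ('X_[u] : {mpoly k[n]}).@[char_point chi] = chi (expvec u).
Proof.
move=> chiT; have sgT : is_subgroup [set: 'rV[int]_n] by [].
rewrite mevalX [expvec u]row_sum_delta.
rewrite (big_morph chi (id1 := 1) (op1 := *%R)); last exact: char_on0 chiT.
  apply: eq_bigr => i _; rewrite mxE mnm0E subr0.
  rewrite -[X in X *: _]intz scaler_int (char_onMz _ sgT chiT)//.
by move=> a b; case: chiT => _; apply.
Qed.

Lemma char_on_mul chi psi : char_on setT chi -> char_on setT psi ->
  char_on setT (fun a => psi a * chi a).
Proof.
move=> [chi0 chiD] [psi0 psiD]; split=> [a _|a b _ _].
  by rewrite mulf_neq0 ?chi0 ?psi0.
by rewrite chiD// psiD// mulrACA.
Qed.

Lemma meval_twist chi psi f : char_on setT chi -> char_on setT psi ->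
  (mreweight (fun w => psi (expvec w)) f).@[char_point chi] =
  f.@[char_point (fun a => psi a * chi a)].
Proof.
move=> chiT psiT; rewrite {2}(mpolyE f) /mreweight !raddf_sum /=.
apply: eq_bigr => w _; rewrite !mevalZ !char_pointX ?mulrA//.
exact: char_on_mul.
Qed.

Section FixedLattice.
Variables (L : set 'rV[int]_n) (rho : 'rV[int]_n -> k).
Hypotheses (latL : lattice J L) (charL : character L rho).

Let sgL : is_subgroup L. Proof. by apply/zmod_closedP; case: latL. Qed.

Lemma lattice_ideal_poly_on : lattice_ideal J L rho `<=` poly_on J.
Proof.
move=> f [r [c [g [cJ gG ->]]]]; apply: poly_on_sum => i _.
apply: poly_onM => //; have [u [v [uJ vJ _ ->]]] := gG i.
by apply: poly_onB; [|apply: poly_onZ]; exact: poly_on_monomial.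
Qed.

Lemma lattice_ideal_binom c u v : expon_on J u -> expon_on J v ->
  L (expon_sub u v) ->
  lattice_ideal J L rho (c *: ('X_[u] - rho (expon_sub u v) *: 'X_[v])).
Proof.
move=> uJ vJ Luv; rewrite -mul_mpolyC; apply: ideal_gen_in_sub.
  exact: poly_onC.
by exists u, v.
Qed.

Lemma lattice_ideal_eval chi f : char_on setT chi ->
  (forall a, L a -> chi a = rho a) -> lattice_ideal J L rho f ->
  f.@[char_point chi] = 0.
Proof.
move=> chiT chiE [r [c [g [_ gG ->]]]]; rewrite raddf_sum big1// => i _ /=.
have [u [v [_ _ Luv ->]]] := gG i.
rewrite mevalM mevalB mevalZ !char_pointX// -chiE//.
have [_ chiD] := chiT.
by rewrite -chiD// expvecB subrK subrr mulr0.
Qed.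

(** While two exponents are congruent modulo [L], a multiple of their binomial moves the term of one
    into the other, which lowers the number of terms. *)
Lemma lattice_ideal_reduce h : poly_on J h -> exists h',
  [/\ poly_on J h', lattice_ideal J L rho (h - h') &
    {in msupp h' &, forall u v, L (expon_sub u v) -> u = v}].
Proof.
elim: {h}_.+1 {-2}h (ltnSn (size (msupp h))) => // c IHc h.
rewrite ltnS => szh hJ.
have [red|nred] :=
  pselect {in msupp h &, forall u v, L (expon_sub u v) -> u = v}.
  by exists h; split=> //; rewrite subrr; exact: ideal_gen_in0.
have [u [v [uh vh Luv uv]]] : exists u v,
    [/\ u \in msupp h, v \in msupp h, L (expon_sub u v) & u <> v].
  apply: contrapT => no; apply: nred => u v uh vh Luv.
  by apply: contrapT => uv; apply: no; exists u, v.
have [uJ vJ] := (hJ _ uh, hJ _ vh).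
pose b := h@_u *: ('X_[u] - rho (expon_sub u v) *: 'X_[v] : {mpoly k[n]}).
have Lb : lattice_ideal J L rho b by exact: lattice_ideal_binom.
have [||h' [h'J Lh' redh']] := IHc (h - b).
- apply: leq_trans szh; apply: (@msupp_size_lt _ _ _ _ u) => //.
    move=> w; apply: contraTT => wh;
      rewrite -mcoeff_eq0 mcoeffB mcoeffZ mcoeffB.
    rewrite mcoeffZ !mcoeffX (memN_msupp_eq0 wh).
    case: (eqVneq u w) => [E|_]; first by rewrite -E uh in wh.
    case: (eqVneq v w) => [E|_]; first by rewrite -E vh in wh.
    by rewrite !mulr0 subr0 mulr0 subr0.
  rewrite -mcoeff_eq0 mcoeffB mcoeffZ mcoeffB mcoeffZ !mcoeffX eqxx.
  by rewrite [v == u]eq_sym (negbTE (introN eqP uv)) mulr0 subr0 mulr1 subrr.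
- by apply: poly_onB => //; exact: lattice_ideal_poly_on.
exists h'; split=> //; rewrite -[h](subrK b) -addrA [b - _]addrC addrA.
exact: ideal_gen_inD.
Qed.

Hypothesis k_char0 : [pchar k] =i pred0.

(* Dedekind's independence of characters, on the set of extensions of [rho]. *)
Lemma reduced_vanishing h :
  {in msupp h &, forall u v, L (expon_sub u v) -> u = v} ->
  (forall chi, char_on setT chi -> (forall a, L a -> chi a = rho a) ->
     h.@[char_point chi] = 0) -> h = 0.
Proof.
elim: {h}_.+1 {-2}h (ltnSn (size (msupp h))) => // c IHc h.
rewrite ltnS => szh red van; apply/eqP/negPn/negP => h0.
have [u uh] : exists u, u \in msupp h by exists (mlead h); exact: mlead_supp.
have hu0 : h@_u != 0 by rewrite -mcoeff_msupp.
(* A single term cannot vanish at a point of the torus, and [rho] has at least one extension. *)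
have [one|none] := pselect (forall v, v \in msupp h -> v = u).
  have [chi chiT chiE] := char_extend sgL charL.
  have hE : h = h@_u *: 'X_[u].
    apply/mpolyP => v; rewrite mcoeffZ mcoeffX; case: eqVneq => [->|uv].
      by rewrite mulr1.
    rewrite mulr0; apply: memN_msupp_eq0; apply: contraNN uv => /one->.
    exact: eqxx.
  have := van chi chiT chiE; rewrite hE mevalZ char_pointX// => /eqP.
  by rewrite mulf_eq0 (negbTE hu0)/=; apply/negP; case: chiT => + _; apply.
have [v [vh uv]] : exists v, v \in msupp h /\ v <> u.
  apply: contrapT => no; apply: none => v vh.
  by apply: contrapT => uv; apply: no; exists v.
have nLvu : ~ L (expon_sub v u) by move/(red _ _ vh uh).
have [psi [psiT psi1 psivu]] := char_separate k_char0 sgL nLvu.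
(* Since [psi] is trivial on [L], its product with an extension of [rho] is again one, so [g]
   vanishes at all extensions too. It has lost the term at [u] but, as [psi] separates [v] from [u],
   not the one at [v]. *)
pose g := mreweight (fun w => psi (expvec w) - psi (expvec u)) h.
have gE : g = mreweight (fun w => psi (expvec w)) h - psi (expvec u) *: h.
  apply/mpolyP => w; rewrite mcoeffB mcoeffZ !mcoeff_mreweight mulrBr.
  by rewrite [psi _ * h@_w]mulrC.
have gh : {subset msupp g <= msupp h} by exact: msupp_mreweight.
have g0 : g = 0.
  apply: IHc.
  - apply: leq_trans szh; apply: (msupp_size_lt gh uh).
    by rewrite -mcoeff_eq0 mcoeff_mreweight subrr mulr0.
  - by move=> w w' /gh wh /gh w'h; exact: red.
  - move=> chi chiT chiE; rewrite gE mevalB mevalZ meval_twist// !van//.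
    + by rewrite mulr0 subr0.
    + exact: char_on_mul.
    + by move=> a La; rewrite psi1// mul1r chiE.
have /eqP : g@_v = 0 by rewrite g0 mcoeff0.
rewrite mcoeff_mreweight mulf_eq0 -[_ == 0]negbK -mcoeff_msupp vh /= subr_eq0.
move=> /eqP psiE; move/eqP: psivu; apply; rewrite expvecB.
have [psi0 psiD] := psiT.
rewrite psiD// psiE -psiD// subrr.
by rewrite (char_on0 sgL)//; split=> *; [exact: psi0|exact: psiD].
Qed.

Lemma lattice_ideal_vanishing f : poly_on J f ->
  (forall chi, char_on setT chi -> (forall a, L a -> chi a = rho a) ->
     f.@[char_point chi] = 0) -> lattice_ideal J L rho f.
Proof.
move=> fJ van; have [h [hJ Lfh red]] := lattice_ideal_reduce fJ.
suff h0 : h = 0 by rewrite h0 subr0 in Lfh.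
apply: reduced_vanishing => // chi chiT chiE.
have := lattice_ideal_eval chiT chiE Lfh.
by rewrite mevalB van// sub0r => /eqP; rewrite oppr_eq0 => /eqP.
Qed.

Lemma lattice_ideal_radical f e : poly_on J f ->
  lattice_ideal J L rho (f ^+ e) -> lattice_ideal J L rho f.
Proof.
move=> fJ Lfe; apply: lattice_ideal_vanishing => // chi chiT chiE.
have := lattice_ideal_eval chiT chiE Lfe.
by rewrite rmorphXn => /eqP; rewrite expf_eq0 => /andP[_ /eqP].
Qed.

(** Otherwise some [psi], trivial on [L], separates [u] from [v]. The binomial vanishes at an
    extension [chi] of [rho] and at [psi * chi]; comparing the two equations gives [psi] the same
    value at [u] and [v]. *)
Lemma lattice_ideal_binom_lattice c u v :
  lattice_ideal J L rho ('X_[u] - c *: 'X_[v]) -> L (expon_sub u v).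
Proof.
move=> Luv; apply: contrapT => nL.
have [psi [psiT psi1 psiuv]] := char_separate k_char0 sgL nL.
have [chi chiT chiE] := char_extend sgL charL.
have := lattice_ideal_eval chiT chiE Luv.
have psichiT : char_on setT (fun a => psi a * chi a) by exact: char_on_mul.
have := lattice_ideal_eval psichiT _ Luv.
rewrite !mevalB !mevalZ !char_pointX// => vanpsi /eqP;
  rewrite subr_eq0 => /eqP vanchi.
have /eqP : psi (expvec u) * chi (expvec u) -
    c * (psi (expvec v) * chi (expvec v)) = 0.
  by apply: vanpsi => a La; rewrite psi1// mul1r chiE.
have [chi0 _] := chiT; have [psi0 psiD] := psiT.
rewrite mulrCA -vanchi -mulrBl mulf_eq0 (negbTE (chi0 _ _))// orbF subr_eq0.
move=> /eqP psiE; move/eqP: psiuv; apply;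
  rewrite expvecB psiD// psiE -psiD// subrr.
by rewrite (char_on0 sgL)//; split=> *; [exact: psi0|exact: psiD].
Qed.

End FixedLattice.
End LatticeIdeals.

(** * Cellular binomial ideals *)

Lemma mreweightM (k : fieldType) n (F F' : 'X_{1..n} -> k)
    (s f : {mpoly k[n]}) :
  (forall a w, a \in msupp s -> F (a + w)%MM = F' w) ->
  mreweight F (s * f) = s * mreweight F' f.
Proof.
move=> FF'; rewrite (mpolyE s) !mulr_suml mreweight_sum.
apply: eq_big_seq => a sa; rewrite -!scalerAl mreweightZ; congr (_ *: _).
rewrite {1}(mpolyE f) mulr_sumr mreweight_sum mulr_sumr; apply: eq_bigr => w _.
by rewrite -!scalerAr -mpolyXD mreweightZ mreweightX FF'// scalerA.
Qed.

Definition mrestrict (k : fieldType) n (C : set 'X_{1..n}) :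
    {mpoly k[n]} -> {mpoly k[n]} :=
  mreweight (fun w => `[< C w >]%:R).

Lemma mcoeff_mrestrict (k : fieldType) n C (f : {mpoly k[n]}) w :
  (mrestrict C f)@_w = if `[< C w >] then f@_w else 0.
Proof. by rewrite mcoeff_mreweight; case: asbool; rewrite ?mulr1 ?mulr0. Qed.

Lemma msupp_mrestrict (k : fieldType) n C (f : {mpoly k[n]}) w :
  (w \in msupp (mrestrict C f)) = `[< C w >] && (w \in msupp f).
Proof.
by rewrite !mcoeff_msupp mcoeff_mrestrict; case: asbool; rewrite ?eqxx.
Qed.

Section Cellular.
Variables (k : closedFieldType) (n : nat) (J : {set 'I_n}).
Variable I : set {mpoly k[n]}.
Hypothesis cellI : cellular J I.
Implicit Types (f g h s : {mpoly k[n]}) (u v w m : 'X_{1..n}).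

Lemma cellular_is_ideal : is_ideal I.
Proof. by case: cellI => -[G _ ->] _ _; exact: is_ideal_gen. Qed.
Let idI := cellular_is_ideal.

Lemma cellular_regular a f : expon_on J a -> I ('X_[a] * f) -> I f.
Proof.
have [_ reg _] := cellI; move=> aJ; rewrite mpolyXE_id.
apply: (big_ind (fun p : {mpoly k[n]} => forall f, I (p * f) -> I f)).
- by move=> g; rewrite mul1r.
- by move=> p q regp regq g; rewrite -mulrA => /regp/regq.
- move=> i _ g; have [iJ|/aJ ->] := boolP (i \in J);
    last by rewrite expr0 mul1r.
  elim: (a i) g => [|e IHe] g; first by rewrite mul1r.
  by rewrite exprS -mulrA => /(reg _ iJ)/IHe.
Qed.

(** Homogeneity of binomial ideals: a monomial multiple of a generator is either a monomial of [I]
    or a binomial with both exponents inside [C] or both outside. *)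
Lemma cellular_restrict (C : set 'X_{1..n}) f :
  (forall u v c, c != 0 -> I ('X_[u] - c *: 'X_[v]) -> C u -> C v) ->
  I f -> I (mrestrict C f).
Proof.
move=> Cstab; have Cstab2 u v c : c != 0 -> I ('X_[u] - c *: 'X_[v]) ->
    `[< C u >] = `[< C v >].
  move=> c0 Iuv; apply/asboolP/asboolP; first exact: Cstab Iuv.
  apply: (@Cstab _ _ c^-1); first by rewrite invr_eq0.
  have := is_idealM (- (c^-1)%:MP) idI Iuv.
  by rewrite mulNr mul_mpolyC scalerBr opprB scalerA mulVf// scale1r.
have [[G Gbin defI] _ _] := cellI; rewrite {1}defI => -[r [c [g [_ Gg ->]]]].
rewrite /mrestrict mreweight_sum; apply: is_ideal_sum => // i _ _.
rewrite (mpolyE (c i)) mulr_suml mreweight_sum; apply: is_ideal_sum => // w _ _.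
rewrite -scalerAl mreweightZ -mul_mpolyC; apply: is_idealM => //.
have Ig : I (g i) by rewrite defI; exact: ideal_gen_sub.
have [u [v [b gE]]] := Gbin _ (Gg i).
have Iwg : I ('X_[w] * g i) by exact: is_idealM.
move: Iwg; rewrite gE mulrBr -scalerAr -!mpolyXD => Iwg.
rewrite -scaleN1r mreweightD !mreweightZ !mreweightX.
have [b0|b0] := eqVneq b 0.
  rewrite b0 !scale0r scaler0 addr0 -mul_mpolyC; apply: is_idealM => //.
  by move: Iwg; rewrite b0 scale0r subr0.
rewrite (Cstab2 _ _ _ b0 Iwg) [b *: (_ *: _)]scalerA [b * _]mulrC -scalerA.
by rewrite scaleN1r -scalerBr -mul_mpolyC; exact: is_idealM.
Qed.

(** * The lattice of the ideal (I : x^m) *)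

Section ColonLattice.
Variable m : 'X_{1..n}.
Hypothesis nIm : ~ I 'X_[m].

Let rel c u v : Prop := I (('X_[u] - c *: 'X_[v]) * 'X_[m]).

Definition colon_lattice : set 'rV[int]_n :=
  [set a | exists u v c, [/\ expon_on J u, expon_on J v, a = expon_sub u v,
     c != 0 & I (('X_[u] - c *: 'X_[v]) * 'X_[m])]].

Let nonzero w c : expon_on J w -> I (c *: ('X_[w] * 'X_[m])) -> c = 0.
Proof.
move=> wJ Iw; apply/eqP/negPn/negP => c0; apply: nIm.
apply: (cellular_regular wJ).
have := is_idealM (c^-1)%:MP idI Iw.
by rewrite mul_mpolyC scalerA mulVf// scale1r.
Qed.

(** Subtracting the two relations leaves [c - d] times a monomial that is not in [I], since the
    variables in [J] are regular. *)
Lemma colon_binom_unique c d u v : expon_on J v ->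
  I (('X_[u] - c *: 'X_[v]) * 'X_[m]) -> I (('X_[u] - d *: 'X_[v]) * 'X_[m]) ->
  c = d.
Proof.
move=> vJ Ic Id; apply/eqP; rewrite -subr_eq0; apply/eqP; apply: (nonzero vJ).
have := is_idealB idI Id Ic; rewrite -mulrBl opprB addrC addrA subrK.
by rewrite -scalerBl -scalerAl.
Qed.

(** As [u' + v = v' + u], multiplying the first relation by ['X_[v']] gives ['X_[v]] times the
    second, and ['X_[v]] can be cancelled. *)
Let rel_translate c u v u' v' : expon_on J v -> expon_on J v' ->
  expon_sub u v = expon_sub u' v' -> rel c u v -> rel c u' v'.
Proof.
move=> vJ v'J E Iuv; apply: (cellular_regular vJ).
have {}E : (u' + v = v' + u)%MM.
  apply/mnmP => i; have /rowP/(_ i) := E; rewrite !mxE !mnmDE => /eqP.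
  rewrite subr_eq addrAC eq_sym subr_eq -!PoszD => /eqP[].
  by rewrite [in RHS]addnC.
have := is_idealM 'X_[v'] idI Iuv; rewrite !mulrA !mulrBr -!scalerAr -!mpolyXD.
by rewrite -E [(v + u')%MM]addmC [(v' + v)%MM]addmC.
Qed.

Let rel_mul c d u v u' v' : rel c u v -> rel d u' v' ->
  rel (c * d) (u + u')%MM (v + v')%MM.
Proof.
move=> Ic Id; have := is_idealD idI (is_idealM 'X_[u'] idI Ic)
  (is_idealM (c *: 'X_[v]) idI Id).
rewrite !mulrA -mulrDl !mulrBr addrA.
rewrite -scalerAr -!scalerAl -scalerAr -!mpolyXD [(u' + v)%MM]addmC subrK.
by rewrite scalerA [(u' + u)%MM]addmC.
Qed.

Let rel_sym c u v : c != 0 -> rel c u v -> rel c^-1 v u.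
Proof.
move=> c0 Ic; have := is_idealM (- (c^-1)%:MP) idI Ic.
by rewrite mulrA mulNr mul_mpolyC scalerBr opprB scalerA mulVf// scale1r.
Qed.

(** The character maps a difference of exponents to the coefficient of its binomial. This depends on
    the difference alone by [rel_translate], and is multiplicative because relations multiply and
    their coefficients are unique. *)
Lemma colon_latticeP : exists rho : 'rV[int]_n -> k,
  [/\ lattice J colon_lattice, character colon_lattice rho
    & forall u v, expon_on J u -> expon_on J v ->
      colon_lattice (expon_sub u v) ->
      I (('X_[u] - rho (expon_sub u v) *: 'X_[v]) * 'X_[m])].
Proof.
have /choice[rho rhoP] a : exists c, colon_lattice a -> c != 0 /\
    forall u v, expon_on J u -> expon_on J v -> a = expon_sub u v -> rel c u v.
  have [[u [v [c [uJ vJ -> c0 Iuv]]]]|na] := pselect (colon_lattice a).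
    exists c => _; split=> // u' v' u'J v'J E.
    exact: (rel_translate vJ v'J E Iuv).
  by exists 0.
have rhoE u v : expon_on J u -> expon_on J v -> colon_lattice (expon_sub u v) ->
    rel (rho (expon_sub u v)) u v.
  by move=> uJ vJ /rhoP[_]; exact.
have Lrel u v c : expon_on J u -> expon_on J v -> c != 0 -> rel c u v ->
    colon_lattice (expon_sub u v).
  by move=> uJ vJ c0 Iuv; exists u, v, c.
have LD u v u' v' : expon_on J u -> expon_on J v -> expon_on J u' ->
    expon_on J v' -> colon_lattice (expon_sub u v) ->
    colon_lattice (expon_sub u' v') ->
    rel (rho (expon_sub u v) * rho (expon_sub u' v')) (u + u')%MM (v + v')%MM.
  by move=> uJ vJ u'J v'J Luv Lu'v'; apply: rel_mul; exact: rhoE.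
have subD u v u' v' :
    expon_sub (u + u')%MM (v + v')%MM = expon_sub u v + expon_sub u' v'.
  by rewrite !expvecB !expvecD opprD addrACA.
exists rho; split=> //.
- split; first by move=> _ [u [v [c [uJ vJ -> _ _]]]]; exact: Zvec_on_expon_sub.
  apply/zmod_closedP; split.
    exists 0%MM, 0%MM, 1.
    split; [exact: expon_on0|exact: expon_on0| |exact: oner_neq0|].
      by rewrite expvecB subrr.
    by rewrite scale1r subrr mul0r; exact: is_ideal0.
  move=> _ _ [u [v [c [uJ vJ -> c0 Ic]]]] [u' [v' [d [u'J v'J -> d0 Id]]]].
  have -> : expon_sub u v - expon_sub u' v' = expon_sub (u + v')%MM (v + u')%MM.
    by rewrite subD; congr (_ + _); rewrite !expvecB opprB.
  apply: (@Lrel _ _ (c * d^-1)); [exact: expon_onD|exact: expon_onD| |].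
    by rewrite mulf_neq0// invr_eq0.
  by apply: rel_mul => //; exact: rel_sym.
- split; first by move=> a /rhoP[].
  move=> _ _ [u [v [c [uJ vJ -> c0 Ic]]]] [u' [v' [d [u'J v'J -> d0 Id]]]].
  have L1 := Lrel _ _ _ uJ vJ c0 Ic; have L2 := Lrel _ _ _ u'J v'J d0 Id.
  have LL := LD _ _ _ _ uJ vJ u'J v'J L1 L2.
  have [uu'J vv'J] := (expon_onD uJ u'J, expon_onD vJ v'J).
  rewrite -subD; apply: (colon_binom_unique vv'J _ LL); apply: rhoE => //.
  apply: Lrel LL => //; rewrite mulf_neq0//.
    by case: (rhoP _ L1).
  by case: (rhoP _ L2).
Qed.

(** For the inclusion from left to right, reduce an element of the colon modulo the lattice ideal.
    In the remainder [h] no two exponents are congruent, so homogeneity of [I] puts each term of [h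
    * 'X_[m]] in [I], which forces [h = 0]. *)
Lemma colon_lattice_idealE rho :
  (forall u v, expon_on J u -> expon_on J v -> colon_lattice (expon_sub u v) ->
      I (('X_[u] - rho (expon_sub u v) *: 'X_[v]) * 'X_[m])) ->
  ideal_colon I 'X_[m] `&` poly_on J = lattice_ideal J colon_lattice rho.
Proof.
move=> rhoE.
have Lcolon : lattice_ideal J colon_lattice rho `<=` ideal_colon I 'X_[m].
  apply: ideal_gen_in_min; first exact: is_ideal_colon.
  by move=> _ [u [v [uJ vJ Luv ->]]]; exact: rhoE.
rewrite eqEsubset; split=> [f [If fJ]|f Lf]; last first.
  by split; [exact: Lcolon|exact: lattice_ideal_poly_on Lf].
have [h [hJ Lfh red]] := lattice_ideal_reduce colon_lattice rho fJ.
suff h0 : h = 0 by rewrite h0 subr0 in Lfh.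
have Ih : I (h * 'X_[m]).
  have := is_idealB idI If (Lcolon _ Lfh).
  by rewrite -mulrBl opprB addrC subrK.
apply/eqP/negPn/negP => hn0.
have [u uh] : exists u, u \in msupp h by exists (mlead h); exact: mlead_supp.
(* [h] being reduced, [u + m] is its only monomial in this class. *)
pose C w := exists2 c, c != 0 & I ('X_[u + m] - c *: 'X_[w]).
have IC : I (mrestrict C (h * 'X_[m])).
  apply: cellular_restrict => // v w c c0 Ivw [d d0 Id].
  exists (d * c); first by rewrite mulf_neq0.
  have := is_idealD idI Id (is_idealM d%:MP idI Ivw).
  by rewrite mul_mpolyC scalerBr addrA subrK scalerA.
have hE : mrestrict C (h * 'X_[m]) = h@_u *: ('X_[u] * 'X_[m]).
  rewrite /mrestrict mulrC.
  rewrite (@mreweightM _ _ _ (fun w => `[< C (w + m)%MM >]%:R)); last first.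
    by move=> a w; rewrite msuppX inE => /eqP ->; rewrite addmC.
  rewrite mulrC scalerAl; congr (_ * _); apply/mpolyP => w.
  rewrite mcoeff_mreweight mcoeffZ mcoeffX; case: eqVneq => [<-|uw].
    rewrite asboolT //; exists 1; first exact: oner_neq0.
    by rewrite scale1r subrr; exact: is_ideal0.
  rewrite mulr0; have [wh|wh] := boolP (w \in msupp h); last first.
    by rewrite (memN_msupp_eq0 wh) mul0r.
  rewrite asboolF ?mulr0// => -[c c0]; rewrite !mpolyXD scalerAl -mulrBl => Iuw.
  move/eqP: uw; apply; apply: red => //; exists u, w, c; split=> //; exact: hJ.
move: IC; rewrite hE => /(nonzero (hJ _ uh))/eqP.
by rewrite mcoeff_eq0 uh.
Qed.

End ColonLattice.

Lemma colon_has_lattice m : ~ I 'X_[m] ->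
  has_lattice J (ideal_colon I 'X_[m] `&` poly_on J) (colon_lattice m).
Proof.
move=> nIm; have [rho [latL charL rhoE]] := colon_latticeP nIm.
by split=> //; exists rho => //; exact: colon_lattice_idealE.
Qed.

End Cellular.

(** * Saturation by the complement of the unique minimal prime *)

Section OneMinimalPrime.
Variables (k : closedFieldType) (n : nat) (J : {set 'I_n}).
Variables I P : set {mpoly k[n]}.
Hypothesis k_char0 : [pchar k] =i pred0.
Hypothesis cellI : cellular J I.
Hypotheses (prP : prime_ideal P) (radP : P = radical I).
Implicit Types (f g h s : {mpoly k[n]}) (u v w m : 'X_{1..n}).

Let idI : is_ideal I := cellular_is_ideal cellI.
Let idP : is_ideal P := prime_ideal_is_ideal prP.

Let IP : I `<=` P. Proof. by rewrite radP; exact: sub_radical. Qed.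

Let nI1 : ~ I 1. Proof. by move/IP; exact: prime_ideal1. Qed.

Let nIX0 : ~ I 'X_[0%MM]. Proof. by rewrite mpolyX0. Qed.

(** Makes the lattice of [I] in k[J] the case [m = 0] of the colon lattices. *)
Let colon0 : ideal_colon I 'X_[0%MM] = I.
Proof.
by rewrite /ideal_colon mpolyX0; apply/funext => f /=; rewrite mulr1.
Qed.

Lemma radical_poly_on f : poly_on J f -> P f -> I f.
Proof.
rewrite radP => fJ [e Ife].
have [latL [rho charL defL]] := colon_has_lattice cellI nIX0.
rewrite colon0 in defL.
have : lattice_ideal J (colon_lattice J I 0%MM) rho (f ^+ e).
  by rewrite -defL; split=> //; exact: poly_onXn.
by move/(lattice_ideal_radical latL charL k_char0 fJ); rewrite -defL => -[].
Qed.

(** Let [s0] be the part of [s] in k[J]. Every monomial of [s - s0] involves a nilpotent variable,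
    so some power [(s0 - s) ^+ e] is in [I]; as [s] divides [s0 ^+ e - (s0 - s) ^+ e], the power
    [s0 ^+ e] takes [f] into [I]. *)
Lemma outside_prime_poly_on f s : ~ P s -> I (s * f) ->
  exists t, [/\ poly_on J t, ~ P t & I (t * f)].
Proof.
move=> nPs Isf.
pose s0 := mrestrict (expon_on J) s.
have s0J : poly_on J s0 by move=> u; rewrite msupp_mrestrict => /andP[/asboolP].
have Ps1 : P (s - s0).
  rewrite [X in P X]mpolyE; apply: is_ideal_sum => // u us _.
  rewrite -mul_mpolyC; apply: is_idealM => //.
  have : ~ expon_on J u.
    move=> uJ; move: us; rewrite mcoeff_msupp mcoeffB mcoeff_mrestrict.
    by rewrite asboolT// subrr eqxx.
  move=> nuJ; have [i [iJ ui]] : exists i, i \notin J /\ u i != 0%N.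
    apply: contrapT => no; apply: nuJ => i iJ; apply: contrapT => /eqP ui.
    by apply: no; exists i.
  have [_ _ nil] := cellI; have [e Ie] := nil i iJ.
  have Pi : P 'X_i by apply: (prime_idealX (e := e)) => //; exact: IP.
  rewrite mpolyXE_id (bigD1 i)//= mulrC; apply: is_idealM => //.
  by rewrite -[u i]prednK ?lt0n// exprSr; exact: is_idealM.
have [e Ie] : radical I (s0 - s) by rewrite -radP -opprB; exact: is_idealN.
exists (s0 ^+ e); split.
- exact: poly_onXn.
- move/(prime_idealX prP) => Ps0; apply: nPs.
  by rewrite -[s](subrK s0); exact: is_idealD.
- have -> : s0 ^+ e * f = (s0 - s) ^+ e * f +
    (\sum_(i < e) s0 ^+ (e.-1 - i) * (s0 - s) ^+ i) * (s * f).
    have := subrXX s0 (s0 - s) e; rewrite [- (s0 - s)]opprB.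
    rewrite [s0 + (s - s0)]addrC subrK => /eqP; rewrite subr_eq => /eqP ->.
    by rewrite mulrA -mulrDl addrC [s * _]mulrC.
  apply: is_idealD => //; last exact: is_idealM.
  by rewrite mulrC; exact: is_idealM.
Qed.

Lemma monomial_Memb u s : poly_on J s -> ~ P s -> I (s * 'X_[u]) ->
  ideal_add I (Memb J I) 'X_[u].
Proof.
move=> sJ nPs Isu; have idM : is_ideal (Memb J I) by exact: is_ideal_gen.
have idIM := is_ideal_add idI idM.
pose a := [multinom (if i \in J then u i else 0%N) | i < n].
pose m := [multinom (if i \in J then 0%N else u i) | i < n].
have uE : u = (a + m)%MM.
  by apply/mnmP => i; rewrite mnmDE !mnmE; case: (i \in J); rewrite ?addn0.
have aJ : expon_on J a by move=> i iJ; rewrite mnmE (negbTE iJ).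
have mJ : expon_on (~: J)%SET m by move=> i; rewrite inE negbK mnmE => ->.
rewrite uE mpolyXD; apply: is_idealM => //.
have Ism : I (s * 'X_[m]).
  by apply: (cellular_regular cellI aJ); rewrite mulrCA -mpolyXD -uE.
have [Im|nIm] := pselect (I 'X_[m]); first exact: ideal_addl.
apply: ideal_addr => //; apply: ideal_gen_sub.
have haslat := colon_has_lattice cellI nIm.
exists (colon_lattice J I m), m; split=> //; split; first by exists m.
exists (colon_lattice J I 0%MM).
  by have := colon_has_lattice cellI nIX0; rewrite colon0.
split=> [_ [u' [v [c [u'J vJ -> c0 Ic]]]]|sub].
  exists u', v, c; split=> //; rewrite mulrC; apply: is_idealM => //.
  by move: Ic; rewrite mpolyX0 mulr1.
(* If the lattice of [m] were no larger than that of [I], uniqueness of coefficients would make the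
   characters agree on it; then [s], which lies in the lattice ideal of [m], would lie in [I]. *)
have [rho [_ _ rhoE]] := colon_latticeP cellI nIm.
have [rho0 [_ _ rho0E]] := colon_latticeP cellI nIX0.
apply: nPs; apply: IP.
have : lattice_ideal J (colon_lattice J I m) rho s.
  by rewrite -(colon_lattice_idealE cellI nIm rhoE).
apply: ideal_gen_in_min => // _ [u' [v [u'J vJ L ->]]].
have := rho0E _ _ u'J vJ (sub _ L); rewrite mpolyX0 mulr1 => I0.
suff <- : rho0 (expon_sub u' v) = rho (expon_sub u' v) by [].
apply: (colon_binom_unique cellI nIm vJ _ (rhoE _ _ u'J vJ L)).
by rewrite mulrC; exact: is_idealM.
Qed.

(** Induction on the number of terms of [f], with [s] varying. Either some monomial of [f] is itself
    in the saturation and its term is split off, or a whole class of terms is split off and shown to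
    lie in [I]. *)
Lemma poly_on_saturation_sub f s : poly_on J s -> ~ P s -> I (s * f) ->
  ideal_add I (Memb J I) f.
Proof.
have idM : is_ideal (Memb J I) by exact: is_ideal_gen.
have idIM := is_ideal_add idI idM.
elim: {f}_.+1 {-2}f s (ltnSn (size (msupp f))) => // c IHc f s.
rewrite ltnS => szf sJ nPs Isf.
have [->|f0] := eqVneq f 0; first exact: is_ideal0.
have [u uf] : exists u, u \in msupp f by exists (mlead f); exact: mlead_supp.
have [[t [tJ nPt Itu]]|notor] :=
    pselect (exists t, [/\ poly_on J t, ~ P t & I (t * 'X_[u])]).
  rewrite -[f](subrK (f@_u *: 'X_[u])); apply: is_idealD => //; last first.
    rewrite -mul_mpolyC; apply: is_idealM => //.
    exact: monomial_Memb tJ nPt Itu.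
  apply: (IHc _ (t * s)).
  - apply: leq_trans szf; apply: (msupp_size_lt _ uf).
      move=> w; apply: contraTT => wf;
        rewrite -mcoeff_eq0 mcoeffB mcoeffZ mcoeffX.
      case: (eqVneq u w) => [E|_]; first by rewrite -E uf in wf.
      by rewrite (memN_msupp_eq0 wf) mulr0 subr0.
    by rewrite -mcoeff_eq0 mcoeffB mcoeffZ mcoeffX eqxx mulr1 subrr.
  - exact: poly_onM.
  - by case/(prime_idealM prP).
  - rewrite mulrBr; apply: is_idealB => //.
      by rewrite -mulrA; exact: is_idealM.
    rewrite -scalerAr -mul_mpolyC; apply: is_idealM => //.
    by rewrite mulrAC mulrC; exact: is_idealM.
(* The monomials linked to ['X_[u]] by a binomial of [I], up to multiplication
   by monomials of k[J]. *)
pose C w := exists a b d, [/\ expon_on J a, expon_on J b, d != 0 &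
  I ('X_[a + w] - d *: 'X_[b + u])].
have Cu : C u.
  exists 0%MM, 0%MM, 1.
  split; [exact: expon_on0|exact: expon_on0|exact: oner_neq0|].
  by rewrite scale1r subrr; exact: is_ideal0.
have Cstab v w d : d != 0 -> I ('X_[v] - d *: 'X_[w]) -> C v -> C w.
  move=> d0 Ivw [a [b [e [aJ bJ e0 Ie]]]].
  exists a, b, (d^-1 * e); split=> //; first by rewrite mulf_neq0// invr_eq0.
  have := is_idealM (d^-1)%:MP idI
    (is_idealB idI Ie (is_idealM 'X_[a] idI Ivw)).
  rewrite [X in _ - X]mulrBr -scalerAr -!mpolyXD opprB [_ - _ + _]addrC addrA
    subrK.
  by rewrite mul_mpolyC scalerBr !scalerA mulVf// scale1r.
have Cshift a w : expon_on J a -> `[< C (a + w)%MM >] = `[< C w >].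
  move=> aJ; apply/asboolP/asboolP => -[a' [b [d [a'J bJ d0 Id]]]].
    exists (a' + a)%MM, b, d; split=> //; first exact: expon_onD.
    by rewrite -addmA.
  exists a', (a + b)%MM, d; split=> //; first exact: expon_onD.
  have := is_idealM 'X_[a] idI Id.
  by rewrite mulrBr -scalerAr -!mpolyXD !addmA [(a + a')%MM]addmC.
have resM h : poly_on J h -> mrestrict C (h * f) = h * mrestrict C f.
  by move=> hJ; apply: mreweightM => a w /hJ aJ; rewrite Cshift.
have Iscf : I (s * mrestrict C f).
  by rewrite -resM//; exact: (cellular_restrict cellI).
have Icf : I (mrestrict C f).
  have [a [g [aJ gJ Iag]]] : exists a g, [/\ expon_on J a, poly_on J g &
      I ('X_[a] * mrestrict C f - g * 'X_[u])].
    rewrite [mrestrict C f]mpolyE.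
    have : {subset msupp (mrestrict C f) <= [pred w | `[< C w >]]}.
      by move=> w; rewrite msupp_mrestrict => /andP[].
    elim: (msupp _) => [|w r IHr] rC.
      exists 0%MM, 0.
      split; [exact: expon_on0|by rewrite -mpolyC0; exact: poly_onC|].
      by rewrite big_nil mulr0 mul0r subr0; exact: is_ideal0.
    have [|a [g [aJ gJ Ig]]] := IHr.
      by move=> v vr; apply: rC; rewrite inE vr orbT.
    have /asboolP[a' [b [d [a'J bJ d0 Id]]]] : `[< C w >].
      by apply: rC; rewrite inE eqxx.
    set x := (mrestrict C f)@_w; set S := \sum_(_ <- r) _ in Ig *.
    (* A common multiplier for the old terms and the new one: ['X_[a']] rescales the old congruence,
       and ['X_[a]] times the link between [w] and [u] turns [x *: 'X_[w]] into a multiple of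
       ['X_[u]]. *)
    exists (a + a')%MM, ('X_[a'] * g + (x * d) *: 'X_[a + b]); split.
    + exact: expon_onD.
    + apply: poly_onD; first by apply: poly_onM => //; exact: poly_on_monomial.
      by apply: poly_onZ; apply: poly_on_monomial; exact: expon_onD.
    + rewrite big_cons -/S.
      have -> : 'X_[a + a'] * (x *: 'X_[w] + S) -
          ('X_[a'] * g + (x * d) *: 'X_[a + b]) * 'X_[u] =
          'X_[a'] * ('X_[a] * S - g * 'X_[u]) +
          (x *: 'X_[a]) * ('X_[a' + w] - d *: 'X_[b + u]).
        rewrite !mpolyXD -!mul_mpolyC mpolyCM.
        ring.
      by apply: is_idealD => //; exact: is_idealM.
  apply: (cellular_regular cellI aJ).
  have Isgu : I (s * g * 'X_[u]).
    have := is_idealB idI (is_idealM 'X_[a] idI Iscf) (is_idealM s idI Iag).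
    by rewrite mulrCA mulrBr opprB addrC subrK mulrA.
  (* Were [s * g] outside [P], it would witness that ['X_[u]] is in the saturation, which [notor]
     excludes. *)
  have Pg : P g.
    have [|//|//] := prime_idealM prP (f := s) (g := g).
    apply: contrapT => nPsg; apply: notor; exists (s * g); split=> //.
    exact: poly_onM.
  rewrite -[X in I X](subrK (g * 'X_[u])); apply: is_idealD => //.
  by rewrite mulrC; apply: is_idealM => //; exact: radical_poly_on.
rewrite -[f](subrK (mrestrict C f)); apply: is_idealD => //; last first.
  exact: ideal_addl.
apply: (IHc _ s) => //; last by rewrite mulrBr; exact: is_idealB.
apply: leq_trans szf; apply: (msupp_size_lt _ uf).
  move=> w; apply: contraTT => wf; rewrite -mcoeff_eq0 mcoeffB mcoeff_mrestrict.
  by rewrite (memN_msupp_eq0 wf) if_same subr0.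
by rewrite -mcoeff_eq0 mcoeffB mcoeff_mrestrict asboolT// subrr.
Qed.

(** The multiplier is a binomial of the colon whose exponent difference is in [L] but not in [L0].
    In [P] it would be in [I], and its difference would then be in [L0]. *)
Lemma witness_saturation L m : embedded J I L -> witness J I L m ->
  exists2 s, ~ P s & I (s * 'X_[m]).
Proof.
move=> [_ [L0 [latL0 [rho0 char0 defI]] [_ nLL0]]].
move=> [mJ [latL [rho charL defcolon]]].
have [a La nL0a] : exists2 a, L a & ~ L0 a.
  apply: contrapT => no; apply: nLL0 => a La; apply: contrapT => nL0a.
  by apply: no; exists a.
have [LJ _] := latL; have [u [v [uJ vJ aE]]] := Zvec_on_decomp (LJ _ La).
rewrite aE in La nL0a.
have [Ib bJ] : (ideal_colon I 'X_[m] `&` poly_on J)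
    ('X_[u] - rho (expon_sub u v) *: 'X_[v]).
  by rewrite defcolon -[_ - _]scale1r; exact: lattice_ideal_binom.
eexists; last exact: Ib.
move=> /(radical_poly_on bJ) Ib'; apply: nL0a.
apply: (lattice_ideal_binom_lattice latL0 char0 k_char0
  (c := rho (expon_sub u v))).
by rewrite -defI.
Qed.

End OneMinimalPrime.

Theorem proposition6 (k : closedFieldType) (k_char0 : [pchar k] =i pred0)
    (n : nat) (J : {set 'I_n}) (I : set {mpoly k[n]})
    (I_cellular : cellular J I)
    (I_one_minimal_prime : exists! P : set {mpoly k[n]}, minimal_prime I P) :
  Hull I = ideal_add I (Memb J I) /\ binomial_ideal (Hull I).
Proof.
have [P [minP uniqP]] := I_one_minimal_prime.
have {}uniqP P' : minimal_prime I P' -> P' = P by move/uniqP.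
have noeth : noetherian {mpoly k[n]} by exact: mpoly_noetherian.
have idI := cellular_is_ideal I_cellular.
have radP := unique_minimal_prime_radical noeth idI minP uniqP.
have hullE := Hull_unique_minimal_prime noeth idI minP uniqP.
have [prP _ _] := minP.
have idM : is_ideal (Memb J I) by exact: is_ideal_gen.
have idHull : is_ideal (Hull I).
  rewrite hullE; split.
  - by exists 1; [exact: prime_ideal1|rewrite mulr0; exact: is_ideal0].
  - move=> f g [s nPs If] [t nPt Ig]; exists (s * t);
      first by case/(prime_idealM prP).
    rewrite mulrDr; apply: is_idealD => //.
      by rewrite mulrAC mulrC; exact: is_idealM.
    by rewrite -mulrA; exact: is_idealM.
  - move=> a f [s nPs If]; exists s => //.
    by rewrite mulrCA; exact: is_idealM.
have HullE : Hull I = ideal_add I (Memb J I).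
  rewrite eqEsubset; split=> [f|_ [f If [g Mg <-]]].
    rewrite hullE => -[s nPs Isf].
    have [t [tJ nPt Itf]] := outside_prime_poly_on I_cellular prP radP nPs Isf.
    exact: (poly_on_saturation_sub k_char0 I_cellular prP radP tJ nPt Itf).
  apply: is_idealD => //.
    by rewrite hullE; exists 1; [exact: prime_ideal1|rewrite mul1r].
  apply: ideal_gen_in_min Mg => // _ [L [m [embL witm ->]]].
  rewrite hullE.
  exact: (witness_saturation k_char0 I_cellular prP radP embL witm).
split=> //.
have [[G Gbin defI] _ _] := I_cellular.
pose M : set {mpoly k[n]} := [set f | exists L m,
  [/\ embedded J I L, witness J I L m & f = 'X_[m]]].
(* Binomial generators of [I] together with the witnesses, a monomial being a binomial with
   coefficient 0. *)
exists (G `|` M).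
  move=> f [/Gbin//|[L [m [_ _ ->]]]]; exists m, m, 0.
  by rewrite scale0r subr0.
have idGM := is_ideal_gen (G `|` M).
rewrite HullE eqEsubset; split=> [_ [f If [g Mg <-]]|].
  apply: is_idealD => //.
    move: If; rewrite {1}defI; apply: ideal_gen_in_min => // h Gh.
    by apply: ideal_gen_sub; left.
  move: Mg; apply: ideal_gen_in_min => // h Mh.
  by apply: ideal_gen_sub; right.
apply: ideal_gen_in_min; first exact: is_ideal_add.
move=> f [Gf|Mf].
  by apply: ideal_addl => //; rewrite defI; exact: ideal_gen_sub.
by apply: ideal_addr => //; exact: ideal_gen_sub.
Qed.
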